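(* Let $\pi\colon E\to M$ be a vector bundle. Consider a connection in $\pi\colon E\to M$ given by the equivalent elements $\nabla$ (connection form), $\mathrm{H}(\nabla)$ (horizontal subbundle) or $\Psi$ (jet field). Then the following conditions are equivalent: 1. The connection form is invariant under the Liouville vector field $\Delta$: $\mathrm{L}(\Delta)\nabla=0$; or, what is the same thing, the vertical projection operator $\mathfrak{V}=\mathrm{Id}-\nabla$ is invariant by $\Delta$: $\mathrm{L}(\Delta)\mathfrak{V}=0$. 2. The Liouville vector field preserves the horizontal subbundle; that is, for every $t\in\mathbb{R}^+$ and every $y\in E$, $\mathrm{T}_y\Phi_t(\mathrm{H}_y(\nabla))=\mathrm{H}_{\Phi_t(y)}(\nabla)$. 3. If $(x^\mu,y^i)$ is a bundle system of coordinates in the vector bundle $\pi\colon E\to M$, then the functions $\Gamma^i_\mu$ which characterize the connection are linear on the fibers and their expressions are $\Gamma^i_\mu=\pi^*(-\Gamma^i_{j\mu})\,y^j$, where the $\Gamma^i_{j\mu}$ are smooth functions on (the coordinate domain in) $M$. 4. The jet field $\Psi$ is a vector bundle morphism (from $E\to M$ to the vector bundle $J^1\pi\to M$). 5. For every $f\in C^\infty(M)$ and every section $\phi\colon M\to E$, $\tilde\nabla(f\phi)=\mathrm{d}f\otimes\phi+f\,\tilde\nabla\phi$.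
   Context: All manifolds are real, second countable and $C^\infty$; maps and structures are $C^\infty$; repeated indices are summed. $\mathrm{V}(\pi)=\ker\mathrm{T}\pi$. A connection in $\pi\colon E\to M$ is given by any of the following equivalent data: a connection form $\nabla$, i.e. a $C^\infty(E)$-linear map $\nabla\colon\mathfrak{X}(E)\to\mathfrak{X}(E)$ (a $(1,1)$-tensor field on $E$) vanishing on vertical fields with $\alpha\circ\nabla=\alpha$ for every $1$-form $\alpha$ on $E$ vanishing on $\mathrm{V}(\pi)$; the horizontal subbundle $\mathrm{H}(\nabla)=\operatorname{Im}\nabla$, satisfying $\mathrm{T}E=\mathrm{V}(\pi)\oplus\mathrm{H}(\nabla)$; the jet field $\Psi\colon E\to J^1\pi$, the section of $\pi^1\colon J^1\pi\to E$ (1-jets of local sections of $\pi$) such that $\mathrm{H}_y(\nabla)=\operatorname{Im}\mathrm{T}_{\pi(y)}\phi$ for any representative $\phi$ of $\Psi(y)$. In coordinates $(x^\mu,y^i)$ adapted to the bundle, $\nabla=\mathrm{d}x^\mu\otimes\left(\frac{\partial}{\partial x^\mu}+\Gamma^i_\mu\frac{\partial}{\partial y^i}\right)$, which defines the functions $\Gamma^i_\mu(x,y)$, and $\Psi=(x^\mu,y^i,\Gamma^i_\mu)$. When $E\to M$ is a vector bundle, so is $J^1\pi\to M$, with operations induced by those on sections. A bundle system of coordinates on a vector bundle has the $y^i$ linear on fibers. The Liouville vector field $\Delta\in\mathfrak{X}(E)$ is the vertical field whose value at $u\in E_p$ is $u$ itself under $\mathrm{T}_uE_p\cong E_p$; locally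 $\Delta=y^i\frac{\partial}{\partial y^i}$. For $t\in\mathbb{R}^+$ (positive reals), $\Phi_t\colon E\to E$ is $\Phi_t(y)=ty$ (the reparametrized flow of $\Delta$). $\mathrm{L}(\Delta)$ is the Lie derivative. The covariant derivative $\tilde\nabla\colon\Gamma(\pi)\to\Gamma(\pi)\otimes\Omega^1(M)$ induced by a connection is defined, for a section $\phi$, $Z\in\mathfrak{X}(M)$, $p\in M$, by $(\tilde\nabla\phi)(p;Z)=\sharp_{\phi(p)}\left[\mathrm{T}_p\phi(Z_p)-\nabla(\phi(p);\mathrm{T}_p\phi(Z_p))\right]$, where $\sharp_{\phi(p)}\colon\mathrm{V}_{\phi(p)}(\pi)=\mathrm{T}_{\phi(p)}E_p\to E_p$ is the natural identification. *)

(* Defs.v *)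
From HB Require Import structures.
From mathcomp Require Import all_boot all_order all_algebra.
From mathcomp Require Import all_classical all_reals all_analysis.

Set Implicit Arguments.
Unset Strict Implicit.
Unset Printing Implicit Defensive.
Import Order.TTheory GRing.Theory Num.Theory.
Import numFieldNormedType.Exports.

Local Open Scope classical_set_scope.
Local Open Scope ring_scope.

Section SmoothCalculus.
Context {R : realType} {V W : normedModType R}.

(* Used with [U] open and [V] finite dimensional, where f is C^(k+1) iff it is
   differentiable with all its directional derivatives C^k. *)
Fixpoint Ck (k : nat) (U : set V) (f : V -> W) : Prop :=
  match k with
  | 0 => forall z, U z -> {for z, continuous f}
  | k'.+1 => (forall z, U z -> differentiable f z) /\
             forall v, Ck k' U (fun z => 'd f z v)
  end.

Definition smooth_on (U : set V) (f : V -> W) := forall k, Ck k U f.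

Definition smooth_near (f : V -> W) (z : V) :=
  exists2 U, open_nbhs z U & smooth_on U f.

End SmoothCalculus.

Section Charts.
Context {R : realType} {n : nat} {T : Type}.

(* [cfun] is only meaningful on [cdom], and [cinv] on [cimg]. *)
Record chart := Chart {
  cdom : set T;
  cfun :> T -> 'rV[R]_n;
  cinv : 'rV[R]_n -> T }.

Definition cimg (c : chart) : set 'rV[R]_n := c @` cdom c.

Definition is_chart (c : chart) :=
  open (cimg c) /\ forall p, cdom c p -> cinv c (c p) = p.

Definition transition_ok (c d : chart) :=
  open (c @` (cdom c `&` cdom d)) /\
  smooth_on (c @` (cdom c `&` cdom d)) (d \o cinv c).

Definition compatible (c d : chart) := transition_ok c d /\ transition_ok d c.

End Charts.
Arguments chart {R} n T.

(* [T] with the topology for which the charts of [A] are homeomorphisms between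
   open sets. *)
Definition atlas_space (R : realType) n (T : choiceType)
  (A : set (chart (R := R) n T)) : Type := T.

Section AtlasTopology.
Context {R : realType} {n : nat} {T : choiceType}.
Variable A : set (chart (R := R) n T).

Definition atlas_open (U : set T) :=
  forall c p, A c -> cdom c p -> U p -> \forall z \near c p, U (cinv c z).

Lemma atlas_openT : atlas_open setT.
Proof. by move=> c p _ _ _; exact: filterT. Qed.

Lemma atlas_openI : setI_closed atlas_open.
Proof.
move=> U V oU oV c p Ac cp [Up Vp].
by apply: filterI; [exact: oU|exact: oV].
Qed.

Lemma atlas_open_bigU (I : Type) (f : I -> set T) :
  (forall i, atlas_open (f i)) -> atlas_open (\bigcup_i f i).
Proof.
move=> of_ c p Ac cp [i _ fip].
by apply: filterS (of_ i c p Ac cp fip) => z fiz; exists i.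
Qed.

HB.instance Definition _ := Choice.copy (atlas_space A) T.
HB.instance Definition _ := isOpenTopological.Build (atlas_space A)
  atlas_openT atlas_openI atlas_open_bigU.

End AtlasTopology.

(* [chart_at] is an arbitrary choice of a chart around each point; it serves
   only to represent tangent vectors. *)
Record manifold (R : realType) (n : nat) (T : choiceType) := Manifold {
  atlas : set (chart (R := R) n T);
  chart_at : T -> chart n T;
  chart_at_atlas : forall p, atlas (chart_at p);
  chart_at_dom : forall p, cdom (chart_at p) p;
  atlas_chart : forall c, atlas c -> is_chart c;
  atlas_compatible : forall c d, atlas c -> atlas d -> compatible c d;
  manifold_hausdorff : hausdorff_space (atlas_space atlas);
  manifold_second_countable : @second_countable (atlas_space atlas) }.

Section SmoothMaps.
Context {R : realType}.

Definition max_atlas n T (A : manifold R n T) (c : chart n T) :=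
  is_chart c /\ forall d, atlas A d -> compatible c d.

(* The first conjunct, together with the continuity of the coordinate
   expression, is continuity of [f] near [p]. *)
Definition smooth_map_at n T (A : manifold R n T) n' T' (B : manifold R n' T')
    (f : T -> T') (p : T) :=
  forall c d, atlas A c -> atlas B d -> cdom c p -> cdom d (f p) ->
    (\forall z \near c p, cdom d (f (cinv c z))) /\
    smooth_near (d \o f \o cinv c) (c p).

Definition smooth_map n T (A : manifold R n T) n' T' (B : manifold R n' T')
    (f : T -> T') := forall p, smooth_map_at A B f p.

Definition smooth_fun_on n T (A : manifold R n T) (U : set T) (f : T -> R) :=
  forall c p, atlas A c -> cdom c p -> U p -> smooth_near (f \o cinv c) (c p).

Definition smooth_fun n T (A : manifold R n T) (f : T -> R) :=
  smooth_fun_on A setT f.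

End SmoothMaps.

(* A tangent vector at [p] is represented by its components ['rV_n] in the
   chart [chart_at p]; vector fields on an [n]-manifold [T] are thus functions
   [T -> 'rV_n], and (1,1)-tensor fields are [T -> 'rV_n -> 'rV_n]. *)
Section Tangent.
Context {R : realType} {n : nat} {T : choiceType}.
Variable A : manifold R n T.

Definition tcoord (c : chart n T) (p : T) (v : 'rV[R]_n) : 'rV[R]_n :=
  'd (c \o cinv (chart_at A p)) (chart_at A p p) v.

(* tangent vector at p with components w in the chart c *)
Definition tvec (c : chart n T) (p : T) (w : 'rV[R]_n) : 'rV[R]_n :=
  'd (chart_at A p \o cinv c) (c p) w.

Definition tmap n' T' (B : manifold R n' T') (f : T -> T') (p : T)
    (v : 'rV[R]_n) : 'rV[R]_n' :=
  'd (chart_at B (f p) \o f \o cinv (chart_at A p)) (chart_at A p p) v.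

Definition dfun (f : T -> R) (p : T) (v : 'rV[R]_n) : R :=
  'd (f \o cinv (chart_at A p)) (chart_at A p p) v.

Definition vrep (c : chart n T) (X : T -> 'rV[R]_n) (z : 'rV[R]_n) : 'rV[R]_n :=
  tcoord c (cinv c z) (X (cinv c z)).

Definition smooth_vf (X : T -> 'rV[R]_n) :=
  forall c, atlas A c -> smooth_on (cimg c) (vrep c X).

Definition bracket (X Y : T -> 'rV[R]_n) (p : T) : 'rV[R]_n :=
  let c := chart_at A p in
  'd (vrep c Y) (c p) (X p) - 'd (vrep c X) (c p) (Y p).

(* (L_Z N)(X) = [Z, N X] - N [Z, X] *)
Definition lie_tensor (Z : T -> 'rV[R]_n) (N : T -> 'rV[R]_n -> 'rV[R]_n)
    (X : T -> 'rV[R]_n) (p : T) : 'rV[R]_n :=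
  bracket Z (fun q => N q (X q)) p - N p (bracket Z X p).

Definition tensor11 (N : T -> 'rV[R]_n -> 'rV[R]_n) :=
  (forall p, linear (N p)) /\
  forall X, smooth_vf X -> smooth_vf (fun p => N p (X p)).

Definition one_form (alpha : T -> 'rV[R]_n -> R) :=
  (forall p, linear (alpha p : 'rV[R]_n -> R^o)) /\
  forall X, smooth_vf X -> smooth_fun A (fun p => alpha p (X p)).

End Tangent.

Section VectorBundle.
Context {R : realType} {m k : nat} {M : choiceType}.
Variables (MM : manifold R m M) (F : M -> lmodType R).

Notation E := {p : M & F p}.

(* A bundle system of coordinates (x^mu, y^i): the chart [e] of the total space
   has components [x^mu] in its first [m] columns and [y^i] in its last [k]
   ones. *)
Definition ycoord (e : chart (m + k) E) (u : E) : 'rV[R]_k := rsubmx (e u).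

Definition bundle_chart (EE : manifold R (m + k) E)
    (x : chart m M) (e : chart (m + k) E) :=
  [/\ max_atlas MM x, max_atlas EE e,
      cdom e = tag @^-1` cdom x,
      (forall u, cdom e u -> lsubmx (e u) = x (tag u)) &
      forall p, cdom x p -> linear (fun w : F p => ycoord e (Tagged F w))].

(* Local triviality: a local trivialization over the domain of a chart of the
   base is the same thing as a bundle system of coordinates (the linear maps
   given by the y^i on the fibres are automatically bijective, since [e] is
   injective with open image). *)
Definition is_vector_bundle (EE : manifold R (m + k) E) :=
  forall p, exists x e, bundle_chart EE x e /\ cdom x p.

Variable EE : manifold R (m + k) E.

Definition section_map (phi : forall p, F p) (p : M) : E := Tagged F (phi p).

Definition smooth_section_at (phi : forall p, F p) (p : M) :=
  smooth_map_at MM EE (section_map phi) p.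

Definition smooth_section (phi : forall p, F p) :=
  forall p, smooth_section_at phi p.

Definition vertical (y : E) : set 'rV[R]_(m + k) :=
  [set v | tmap EE MM tag y v = 0].

(* E_p -> T_y E_p, w |-> velocity at t = 0 of y + t w *)
Definition vlift (y : E) (w : F (tag y)) : 'rV[R]_(m + k) :=
  derive1 (fun t : R => chart_at EE y (Tagged F (tagged y + t *: w))) 0.

Definition sharp (y : E) (v : 'rV[R]_(m + k)) : F (tag y) :=
  xget 0 [set w | vlift w = v].

Definition liouville (y : E) : 'rV[R]_(m + k) := vlift (tagged y).

Definition dilation (t : R) (y : E) : E := Tagged F (t *: tagged y).

Definition connection_form (N : E -> 'rV[R]_(m + k) -> 'rV[R]_(m + k)) :=
  [/\ tensor11 EE N,
      (forall y v, vertical y v -> N y v = 0) &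
      forall alpha, one_form EE alpha ->
        (forall y v, vertical y v -> alpha y v = 0) ->
        forall y v, alpha y (N y v) = alpha y v].

Definition horizontal (N : E -> 'rV[R]_(m + k) -> 'rV[R]_(m + k)) (y : E) :
  set 'rV[R]_(m + k) := range (N y).

Definition covder (N : E -> 'rV[R]_(m + k) -> 'rV[R]_(m + k))
    (phi : forall p, F p) (p : M) (z : 'rV[R]_m) : F p :=
  let v := tmap MM EE (section_map phi) p z in
  @sharp (section_map phi p) (v - N (section_map phi p) v).

(* the y^i-component of N(d/dx^mu) at u *)
Definition Gamma (N : E -> 'rV[R]_(m + k) -> 'rV[R]_(m + k))
    (e : chart (m + k) E) (i : 'I_k) (mu : 'I_m) (u : E) : R :=
  tcoord EE e u (N u (tvec EE e u (delta_mx 0 (lshift k mu)))) 0 (rshift m i).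

(* The 1-jet at [p] of [phi], as an equivalence class.  Local sections around
   [p] are represented by arbitrary global extensions. *)
Definition jet1 (p : M) (phi : forall q, F q) : set (forall q, F q) :=
  [set psi | [/\ smooth_section_at psi p, psi p = phi p &
     tmap MM EE (section_map psi) p = tmap MM EE (section_map phi) p]].

Record jet (p : M) := Jet {
  jclass : set (forall q, F q);
  jclassP : exists phi, smooth_section_at phi p /\ jclass = jet1 p phi }.

Definition jrep p (j : jet p) : forall q, F q := projT1 (cid (jclassP j)).

(* a j^1 phi + j^1 psi = j^1 (a phi + psi) *)
Definition jet_lin p (a : R) (j j' : jet p) : set (forall q, F q) :=
  jet1 p (fun q => a *: jrep j q + jrep j' q).

(* The coordinates (x^mu, y^i, y^i_mu) on J^1 induced by a bundle system of
   coordinates; the last component is the matrix with rows indexed by mu. *)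
Definition jet_coord (x : chart m M) (e : chart (m + k) E) p (j : jet p) :
    'rV[R]_(m + k) * 'M[R]_(m, k) :=
  (e (section_map (jrep j) p),
   \matrix_(mu, i)
     ('d (ycoord e \o section_map (jrep j) \o cinv x) (x p)
        (delta_mx 0 mu : 'rV[R]_m)) 0 i).

(* Smoothness of a map E -> J^1 over the identity of M, in the induced
   coordinates on both sides. *)
Definition jet_smooth (Psi : forall y : E, jet (tag y)) :=
  forall x e, bundle_chart EE x e ->
    smooth_on (cimg e) (fun z => jet_coord x e (Psi (cinv e z))).

Definition jet_field (Psi : forall y : E, jet (tag y)) :=
  (forall y phi, jclass (Psi y) phi -> phi (tag y) = tagged y) /\ jet_smooth Psi.

Definition jet_field_of (N : E -> 'rV[R]_(m + k) -> 'rV[R]_(m + k))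
    (Psi : forall y : E, jet (tag y)) :=
  jet_field Psi /\
  forall y phi, jclass (Psi y) phi ->
    horizontal N y = range (tmap MM EE (section_map phi) (tag y)).

(* vector bundle morphism E -> J^1 over the identity of M *)
Definition jet_bundle_morphism (Psi : forall y : E, jet (tag y)) :=
  jet_smooth Psi /\
  forall p (a : R) (u v : F p),
    jclass (Psi (Tagged F (a *: u + v))) =
      jet_lin a (Psi (Tagged F u)) (Psi (Tagged F v)).

End VectorBundle.

(* Main.v *)
Require Import Defs.
From HB Require Import structures.
From mathcomp Require Import all_boot all_order all_algebra.
From mathcomp Require Import all_classical all_reals all_analysis.
From mathcomp Require Import ring lra.
Set Implicit Arguments.
Unset Strict Implicit.
Unset Printing Implicit Defensive.
Import Order.TTheory GRing.Theory Num.Theory.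
Import numFieldNormedType.Exports.
Local Open Scope classical_set_scope.
Local Open Scope ring_scope.

(** Fix bundle coordinates (x, y).  The connection form is determined by the
    m x k matrix g(x, y) of its coefficients Gamma [conn_coeff]: it sends the tangent vector
    with components (a, b) to (a, a g), because it kills vertical vectors and
    preserves the forms dx^mu [N_chart].  Every condition of the theorem turns
    out to say that g is linear in the fibre variable y, in one of three
    guises: g is positively homogeneous of degree one along the fibres, g
    satisfies Euler's equation (the derivative of g along (0, y) is g), or g is
    linear on the fibres.  The three are equivalent for a function that is
    differentiable on the whole fibre: integrating Euler's equation along a
    ray gives homogeneity [euler_homogeneous], and a homogeneous function that
    is differentiable at the origin coincides with its differential there, so
    that it is linear [homogeneous_diff0].

    The Liouville field has components (0, y), and the Lie derivative of the
    connection form evaluated on a field X with horizontal components a has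
    components (0, a (g' - g)), where g' is the derivative of g along (0, y)
    [lie_tensor_chart]; its vanishing is Euler's equation.  The dilation by t
    acts on components as (a, b) -> (a, t b), and it preserves the horizontal
    spaces (the graphs b = a g) exactly when g(x, t y) = t g(x, y)
    [dilation_horizontal].  A jet in the image of the jet field is given by its
    value y and its derivative a -> a g(x, y) [jet_derivative], so that the jet
    field is linear exactly when g is.  Finally the covariant derivative of
    phi along a is the derivative of phi minus a g(phi) [covder_chart]; its
    Leibniz rule for constant factors is homogeneity of g, and linearity of g
    gives the rule for all factors.

    Three ingredients have to be supplied.  The conditions speak of global
    fields, forms and sections whereas the computations are local; smooth bump
    functions, extended by zero using that the manifold is separated
    [bump_manifold], bridge the gap.  Smoothness is defined by iterated
    directional derivatives, so closure under composition has to be proved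
    [Ck_comp].  And the bracket of two fields, defined in one particular chart
    at each point, has to be computed in bundle coordinates [bracket_chart];
    its independence of the chart rests on the symmetry of second derivatives
    [schwarz].  The smoothness of g comes for free from the smoothness of the
    jet field, of which g is a component [conn_coeff_smooth]. *)

(** * Calculus of C^k functions *)

Section Calculus.
Context {R : realType}.
Implicit Types V W : normedModType R.

(** The difference of two functions that agree near [z] vanishes near [z], so its
    remainder is trivially small. *)
Lemma near_eq_differentiable V W (f g : V -> W) (z : V) :
  {near z, f =1 g} -> differentiable f z ->
  differentiable g z /\ 'd g z = 'd f z :> (V -> W).
Proof.
move=> fg df.
have dh : differentiable (g \- f) z /\ forall v, 'd (g \- f) z v = 0.
  have H : continuous (\0 : V -> W) /\
      (g \- f) \o shift z = cst ((g \- f) z) + (\0 : V -> W) +o_ 0 id.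
    split; first by move=> x; exact: cst_continuous.
    apply/eqaddoP => _/posnumP[e].
    have := fg; rewrite nbhs0P => fg0.
    near=> x.
    rewrite /= /cst /= !fctE /= .
    have -> : g (x + z) = f (x + z) by rewrite addrC; symmetry; near: x; exact: fg0.
    have -> : g z = f z by symmetry; exact: (nbhs_singleton fg).
    by rewrite !subrr addr0 subr0 normr0 mulr_ge0.
  pose L : {linear V -> W} := \0.
  have dE : 'd (g \- f) z = L :> (V -> W) by apply: diff_unique; case: H.
  split; first by apply/diff_locallyP; rewrite dE; case: H.
  by move=> v; rewrite dE.
case: dh => dh dh0.
have -> : g = f + (g \- f) by apply/funext => x; rewrite fctE addrC subrK.
split; first exact: differentiableD.
rewrite (diffD df dh); apply/funext => v.
by rewrite -[RHS]addr0 -(dh0 v).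
Unshelve. all: by end_near. Qed.

Lemma near_eq_diff V W (f g : V -> W) (z v : V) :
  {near z, f =1 g} -> differentiable f z -> 'd g z v = 'd f z v.
Proof. by move=> fg df; have [_ ->] := near_eq_differentiable fg df. Qed.

Lemma scale_is_bilinear W :
  bilinear_for
    (GRing.Scale.Law.clone _ _ *:%R _) (GRing.Scale.Law.clone _ _ *:%R _)
    (@GRing.scale R W : R -> W -> W).
Proof.
split=> [u'|u] a x y /=.
- by rewrite scalerDl scalerA.
- by rewrite scalerDr !scalerA mulrC.
Qed.

HB.instance Definition _ W := bilinear_isBilinear.Build R R W W _ _
  (@GRing.scale R W : R -> W -> W) (@scale_is_bilinear W).

Lemma diff_scale V W (h : V -> R) (g : V -> W) (z : V) :
  differentiable h z -> differentiable g z ->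
  differentiable (fun x => h x *: g x) z /\
  forall v, 'd (fun x => h x *: g x) z v = h z *: 'd g z v + 'd h z v *: g z.
Proof.
move=> dh dg.
have sc : continuous (fun p : R * W => (p.1 *: p.2 : W)).
  by move=> p; exact: scale_continuous.
have dp := differentiable_pair dh dg.
have ds := @differentiable_bilin _ _ _ _
  (@GRing.scale R W : {bilinear R -> W -> W}) (h z, g z) sc.
split=> [|v].
  exact: (@differentiable_comp _ _ _ _ (fun x => (h x, g x))
    (fun p : R * W => p.1 *: p.2)).
have -> : (fun x => h x *: g x) =
  (fun p : R * W => p.1 *: p.2) \o (fun x => (h x, g x)) by [].
rewrite diff_comp//= diff_pair//.
by rewrite (diff_bilin (h z, g z) sc).
Qed.

Lemma diff_lin_comp V W W' (L : {linear W -> W'}) (f : V -> W) (z v : V) :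
  continuous L -> differentiable f z ->
  differentiable (L \o f) z /\ 'd (L \o f) z v = L ('d f z v).
Proof.
move=> cL df; have dL := linear_differentiable (f z) cL.
split; first exact: differentiable_comp.
by rewrite diff_comp//= diff_lin.
Qed.

Lemma Ck_sub V W k (U U' : set V) (f : V -> W) :
  U' `<=` U -> Ck k U f -> Ck k U' f.
Proof.
elim: k f => [|k IH] f UU' /=; first by move=> h z /UU' /h.
by case=> h1 h2; split=> [z /UU' /h1 //|v]; exact: IH.
Qed.

Lemma CkS V W k (U : set V) (f : V -> W) : Ck k.+1 U f -> Ck k U f.
Proof.
elim: k f => [|k IH] f.
  by case=> h _ z /h; exact: differentiable_continuous.
by case=> h1 h2; split=> // v; apply: IH; exact: h2.
Qed.

Lemma eq_Ck V W k (U : set V) (f g : V -> W) : open U ->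
  (forall z, U z -> f z = g z) -> Ck k U f -> Ck k U g.
Proof.
move=> oU; have nU z : U z -> \forall x \near z, U x.
  by move=> Uz; apply: open_nbhs_nbhs.
elim: k f g => [|k IH] f g fg.
  move=> h z Uz; have fgz : {near z, f =1 g} by apply: filterS (nU _ Uz) => x /fg.
  apply: cvg_trans; first exact: near_eq_cvg fgz.
  by rewrite -fg//; exact: h.
case=> h1 h2.
have fgn z : U z -> {near z, f =1 g} by move=> Uz; apply: filterS (nU _ Uz) => x /fg.
split=> [z Uz|v].
  by have [] := near_eq_differentiable (fgn z Uz) (h1 z Uz).
apply: IH (h2 v) => z Uz.
by rewrite (near_eq_diff _ (fgn z Uz))//; exact: h1.
Qed.

Lemma Ck_cst V W k (U : set V) (a : W) : Ck k U (cst a : V -> W).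
Proof.
elim: k a => [|k IH] a; first by move=> z _; exact: cst_continuous.
split=> [z _|v]; first exact: differentiable_cst.
suff -> : (fun z => 'd (cst a : V -> W) z v) = cst 0 by exact: IH.
by apply/funext => z; rewrite diff_cst.
Qed.

Lemma Ck_lin_comp V W W' k (U : set V) (L : {linear W -> W'}) (f : V -> W) :
  open U -> continuous L -> Ck k U f -> Ck k U (L \o f).
Proof.
move=> oU cL; elim: k f => [|k IH] f.
  by move=> h z /h fc; apply: continuous_comp => //; exact: cL.
case=> h1 h2; split=> [z Uz|v].
  by have [] := diff_lin_comp z cL (h1 _ Uz).
apply: (@eq_Ck _ _ _ _ (L \o (fun z => 'd f z v)) _ oU); last exact: IH (h2 v).
by move=> z Uz; have [_ ->] := diff_lin_comp v cL (h1 _ Uz).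
Qed.

Lemma Ck_lin V W k (U : set V) (L : {linear V -> W}) :
  open U -> continuous L -> Ck k U L.
Proof.
move=> oU cL; case: k => [z Uz|k]; first exact: cL.
split=> [z _|v]; first exact: linear_differentiable.
apply: (@eq_Ck _ _ _ _ (cst (L v))) => //; last exact: Ck_cst.
by move=> z _; rewrite diff_lin.
Qed.

Lemma CkD V W k (U : set V) (f g : V -> W) :
  open U -> Ck k U f -> Ck k U g -> Ck k U (f \+ g).
Proof.
move=> oU; elim: k f g => [|k IH] f g.
  by move=> hf hg z Uz; apply: continuousD; [exact: hf|exact: hg].
case=> f1 f2 [g1 g2]; split=> [z Uz|v].
  by apply: differentiableD; [exact: f1|exact: g1].
apply: (@eq_Ck _ _ _ _ ((fun z => 'd f z v) \+ (fun z => 'd g z v))) => //.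
  by move=> z Uz /=; rewrite [in RHS]diffD//; [exact: f1|exact: g1].
exact: IH (f2 v) (g2 v).
Qed.

Lemma Ck_scale V W k (U : set V) (h : V -> R) (g : V -> W) :
  open U -> Ck k U h -> Ck k U g -> Ck k U (fun z => h z *: g z).
Proof.
move=> oU; elim: k h g => [|k IH] h g.
  by move=> hh hg z Uz; apply: continuousZ; [exact: hh|exact: hg].
move=> hh hg; have hh' := CkS hh; have hg' := CkS hg.
case: hh hg => h1 h2 [g1 g2]; split=> [z Uz|v].
  by have [] := diff_scale (h1 _ Uz) (g1 _ Uz).
apply: (@eq_Ck _ _ _ _
   ((fun z => h z *: 'd g z v) \+ (fun z => 'd h z v *: g z))) => //.
  by move=> z Uz /=; have [_ ->] := diff_scale (h1 _ Uz) (g1 _ Uz).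
by apply: CkD => //; [exact: IH hh' (g2 v)|exact: IH (h2 v) hg'].
Qed.

Lemma Ck_sum V W k (U : set V) (I : Type) (r : seq I) (f : I -> V -> W) : open U ->
  (forall i, Ck k U (f i)) -> Ck k U (fun z => \sum_(i <- r) f i z).
Proof.
move=> oU hf; elim: r => [|i r IH].
  apply: (@eq_Ck _ _ _ _ (cst 0)) => //; last exact: Ck_cst.
  by move=> z _; rewrite big_nil.
apply: (@eq_Ck _ _ _ _ (f i \+ (fun z => \sum_(i <- r) f i z))) => //.
  by move=> z _; rewrite big_cons.
exact: CkD.
Qed.

(** Composition needs a finite-dimensional middle space: expanding the inner
    differential in a basis turns the chain rule into a finite sum of products
    of functions to which the induction hypothesis applies.  The basis is a
    parameter so that the scalars and the row vectors are both covered. *)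
Lemma Ck_comp V V' W n (b : 'I_n -> V') (l : 'I_n -> {linear V' -> R}) k
    (U : set V) (U' : set V') (f : V -> V') (g : V' -> W) :
  (forall i, continuous (l i)) -> (forall v, v = \sum_i l i v *: b i) ->
  open U -> open U' -> (forall z, U z -> U' (f z)) ->
  Ck k U f -> Ck k U' g -> Ck k U (g \o f).
Proof.
move=> cl bl oU oU' UU'; elim: k g => [|k IH] g hf.
  move=> hg z Uz; apply: continuous_comp; first exact: hf.
  by apply: hg; exact: UU'.
have hf' := CkS hf; case: hf => f1 f2 [g1 g2].
split=> [z Uz|v].
  by apply: differentiable_comp; [exact: f1|apply: g1; exact: UU'].
apply: (@eq_Ck _ _ _ _
   (fun z => \sum_(i <- enum 'I_n) (l i \o (fun z => 'd f z v)) z *: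
     ((fun u => 'd g u (b i)) \o f) z)) => //.
  move=> z Uz; rewrite diff_comp; [|exact: f1|by apply: g1; exact: UU'].
  rewrite /= [in RHS](bl ('d f z v)) linear_sum big_enum.
  by apply: eq_bigr => i _; rewrite linearZ.
apply: Ck_sum => // i; apply: Ck_scale => //; last exact: IH hf' (g2 (b i)).
exact: Ck_lin_comp oU (cl i) (f2 v).
Qed.

End Calculus.

(** * Smoothness near a point and differentiation rules *)

Section LocalSmoothness.
Context {R : realType}.
Implicit Types V W : normedModType R.

Lemma near_open (T : topologicalType) (z : T) (P : set T) :
  nbhs z P -> exists2 U, open_nbhs z U & U `<=` P.
Proof. by rewrite nbhsE. Qed.

Lemma smooth_on_near V W (U : set V) (f : V -> W) z :
  open U -> smooth_on U f -> U z -> smooth_near f z.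
Proof. by move=> oU sf Uz; exists U. Qed.

(** Each [C^k] is a condition at every point of the open set, so the
    neighbourhoods need not be uniform in the point. *)
Lemma near_smooth_on V W (U : set V) (f : V -> W) :
  (forall z, U z -> smooth_near f z) -> smooth_on U f.
Proof.
move=> h k.
have {h} : forall z, U z -> exists2 U', open_nbhs z U' & Ck k U' f.
  by move=> z /h[U' oU' sf]; exists U'.
elim: k f => [|k IH] f h.
  by move=> z /h[U' [_ U'z] c]; exact: c.
split=> [z /h[U' [_ U'z] [d _]]|v]; first exact: d.
by apply: IH => z /h[U' oU' [_ d]]; exists U' => //; exact: d.
Qed.

Lemma smooth_near_near V W (f : V -> W) z :
  smooth_near f z -> \forall w \near z, smooth_near f w.
Proof.
case=> U [oU Uz] sf.
apply: filterS (open_nbhs_nbhs (conj oU Uz)) => w Uw.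
exact: (smooth_on_near oU).
Qed.

Lemma near_eq_smooth V W (f g : V -> W) z :
  {near z, f =1 g} -> smooth_near f z -> smooth_near g z.
Proof.
move=> + [U oU sf] => /near_open[U' oU' fg].
have oI := open_nbhsI oU oU'; exists (U `&` U') => // k.
apply: (@eq_Ck _ _ _ _ _ f); first by case: oI.
  by move=> w [_ /fg].
exact: Ck_sub (sf k).
Qed.

Lemma smooth_differentiable V W (f : V -> W) z :
  smooth_near f z -> differentiable f z.
Proof. by case=> U [_ Uz] /(_ 1%N)[h _]; exact: h. Qed.

Lemma smooth_continuous V W (f : V -> W) z :
  smooth_near f z -> {for z, continuous f}.
Proof. by case=> U [_ Uz] /(_ 0%N); apply. Qed.

Lemma smooth_diff V W (f : V -> W) z v :
  smooth_near f z -> smooth_near (fun x => 'd f x v) z.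
Proof. by case=> U oU sf; exists U => // k; have [_ h] := sf k.+1; exact: h. Qed.

Lemma smooth_cst V W (a : W) (z : V) : smooth_near (cst a) z.
Proof.
by exists setT; [split => //; exact: openT|move=> k; exact: Ck_cst].
Qed.

Lemma smooth_lin V W (L : {linear V -> W}) z : continuous L -> smooth_near L z.
Proof.
move=> cL; exists setT; first by split => //; exact: openT.
by move=> k; apply: Ck_lin => //; exact: openT.
Qed.

Lemma smoothD V W (f g : V -> W) z :
  smooth_near f z -> smooth_near g z -> smooth_near (f \+ g) z.
Proof.
case=> U oU sf [U' oU' sg]; have oI := open_nbhsI oU oU'.
exists (U `&` U') => // k.
by apply: CkD; [case: oI|exact: Ck_sub (sf k)|exact: Ck_sub (sg k)].
Qed.

Lemma smooth_scale V W (h : V -> R) (g : V -> W) z :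
  smooth_near h z -> smooth_near g z -> smooth_near (fun x => h x *: g x) z.
Proof.
case=> U oU sf [U' oU' sg]; have oI := open_nbhsI oU oU'.
exists (U `&` U') => // k.
by apply: Ck_scale; [case: oI|exact: Ck_sub (sf k)|exact: Ck_sub (sg k)].
Qed.

Lemma smooth_sum V W (I : Type) (r : seq I) (f : I -> V -> W) z :
  (forall i, smooth_near (f i) z) ->
  smooth_near (fun x => \sum_(i <- r) f i x) z.
Proof.
move=> hf; elim: r => [|i r IH].
  have : smooth_near (cst (0 : W)) z by exact: smooth_cst.
  by apply: near_eq_smooth; near=> x; rewrite big_nil.
have := smoothD (hf i) IH.
by apply: near_eq_smooth; near=> x; rewrite big_cons.
Unshelve. all: by end_near. Qed.

Lemma smooth_lin_comp V W W' (L : {linear W -> W'}) (f : V -> W) z :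
  continuous L -> smooth_near f z -> smooth_near (L \o f) z.
Proof.
move=> cL [U oU sf]; exists U => // k.
by apply: Ck_lin_comp => //; case: oU.
Qed.

Lemma smooth_comp_basis V V' W n (b : 'I_n -> V') (l : 'I_n -> {linear V' -> R})
    (f : V -> V') (g : V' -> W) z :
  (forall i, continuous (l i)) -> (forall v, v = \sum_i l i v *: b i) ->
  smooth_near f z -> smooth_near g (f z) -> smooth_near (g \o f) z.
Proof.
move=> cl bl sf [U' [oU' U'z] sg].
have : \forall x \near z, U' (f x).
  by apply: (smooth_continuous sf); exact: open_nbhs_nbhs.
case: sf => U oU sf /near_open[U1 oU1 fU].
have oI := open_nbhsI oU oU1; exists (U `&` U1) => // k.
apply: (Ck_comp cl bl _ oU') => //; first by case: oI.
  by move=> x [_ /fU].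
exact: Ck_sub (sf k).
Qed.

(** Expanding a matrix in the elementary matrices exhibits a linear map as a finite
    combination of coordinates. *)
Lemma linear_mx_continuous m n W (L : {linear 'M[R]_(m, n) -> W}) : continuous L.
Proof.
have -> : (L : _ -> W) = (fun M => \sum_i \sum_j M i j *: L (delta_mx i j)).
  apply/funext => M; rewrite {1}(matrix_sum_delta M) linear_sum.
  by apply: eq_bigr => i _; rewrite linear_sum; apply: eq_bigr => j _; rewrite linearZ.
apply: continuous_big => [|i _]; first exact: add_continuous.
apply: continuous_big => [|j _ M]; first exact: add_continuous.
apply: (@continuousZr_tmp _ _ _ (fun x : 'M[R]_(m, n) => x i j)).
exact: coord_continuous.
Qed.

Lemma smooth_mx_lin V m n W (L : {linear 'M[R]_(m, n) -> W})
    (f : V -> 'M[R]_(m, n)) z :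
  smooth_near f z -> smooth_near (L \o f) z.
Proof. exact/smooth_lin_comp/linear_mx_continuous. Qed.

Definition entry m n i j (A : 'M[R]_(m, n)) : R^o := A i j.

Fact entry_is_linear m n i j : linear (@entry m n i j).
Proof. by move=> a A B; rewrite /entry !mxE. Qed.

HB.instance Definition _ m n i j :=
  GRing.isLinear.Build R 'M[R]_(m, n) R^o *:%R (@entry m n i j)
    (@entry_is_linear m n i j).

Lemma entry_continuous m n i j : continuous (@entry m n i j).
Proof. exact: linear_mx_continuous. Qed.

Lemma smooth_coord V m n (f : V -> 'M[R]_(m, n)) i j z :
  smooth_near f z -> smooth_near (fun x => f x i j : R) z.
Proof. exact: (@smooth_mx_lin V m n R^o (@entry m n i j)). Qed.

Lemma diff_entry V m n (f : V -> 'M[R]_(m, n)) i j z v : differentiable f z ->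
  differentiable (fun x => f x i j : R) z /\
  'd (fun x => f x i j : R) z v = 'd f z v i j.
Proof. exact: (diff_lin_comp v (@entry_continuous m n i j)). Qed.

Lemma smooth_comp V n W (f : V -> 'rV[R]_n) (g : 'rV[R]_n -> W) z :
  smooth_near f z -> smooth_near g (f z) -> smooth_near (g \o f) z.
Proof.
apply: (@smooth_comp_basis _ _ _ n (fun i => delta_mx 0 i) (@entry 1 n 0)).
  by move=> i; exact: entry_continuous.
by move=> v; rewrite {1}(row_sum_delta v).
Qed.

Lemma smooth_compR V W (f : V -> R) (g : R -> W) z :
  smooth_near f z -> smooth_near g (f z) -> smooth_near (g \o f) z.
Proof.
apply: (@smooth_comp_basis _ _ _ 1 (fun i => (1 : R)) (fun=> idfun)).
  by move=> i x; exact: cvg_id.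
by move=> v; rewrite big_ord1 [_ *: _]mulr1.
Qed.

Lemma smooth_id V (z : V) : smooth_near id z.
Proof. by apply: (@smooth_lin _ _ idfun) => x; exact: cvg_id. Qed.

Lemma smooth_row_mx V m n (f : V -> 'rV[R]_m) (g : V -> 'rV[R]_n) z :
  smooth_near f z -> smooth_near g z ->
  smooth_near (fun x => row_mx (f x) (g x)) z.
Proof.
move=> sf sg.
have := smoothD (smooth_mx_lin (mulmxr (row_mx 1%:M 0)) sf)
                (smooth_mx_lin (mulmxr (row_mx 0 1%:M)) sg).
apply: near_eq_smooth; near=> x.
by rewrite /= !mul_mx_row !mulmx1 !mulmx0 add_row_mx addr0 add0r.
Unshelve. all: by end_near. Qed.

Lemma smooth_diff_apply n W (f : 'rV[R]_n -> W) (xi : 'rV[R]_n -> 'rV[R]_n) z :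
  smooth_near f z -> smooth_near xi z -> smooth_near (fun x => 'd f x (xi x)) z.
Proof.
move=> sf sx.
suff : smooth_near
    (fun x => \sum_(i <- enum 'I_n) xi x 0 i *: 'd f x (delta_mx 0 i)) z.
  apply: near_eq_smooth; near=> x; rewrite big_enum/= [in RHS](row_sum_delta (xi x)).
  by rewrite linear_sum; apply: eq_bigr => i _; rewrite linearZ.
apply: smooth_sum => i; apply: smooth_scale; last exact: smooth_diff.
exact: smooth_coord.
Unshelve. all: by end_near. Qed.

Lemma diff_add V W (f g : V -> W) z :
  differentiable f z -> differentiable g z ->
  differentiable (fun u => f u + g u) z /\
  forall v, 'd (fun u => f u + g u) z v = 'd f z v + 'd g z v.
Proof.
move=> df dg; split; first exact: differentiableD.
by move=> v; exact: (congr1 (fun G : V -> W => G v) (diffD df dg)).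
Qed.

Lemma diff_big V W (I : Type) (r : seq I) (f : I -> V -> W) z :
  (forall i, differentiable (f i) z) ->
  differentiable (fun x => \sum_(i <- r) f i x) z /\
  forall v, 'd (fun x => \sum_(i <- r) f i x) z v = \sum_(i <- r) 'd (f i) z v.
Proof.
move=> hf; elim: r => [|i r [IH1 IH2]].
  have -> : (fun x => \sum_(i <- [::]) f i x) = cst 0.
    by apply/funext => x; rewrite big_nil.
  split=> [|v]; first exact: differentiable_cst.
  by rewrite diff_cst big_nil.
have -> : (fun x => \sum_(i <- i :: r) f i x) = f i + (fun x => \sum_(i <- r) f i x).
  by apply/funext => x; rewrite big_cons.
split=> [|v]; first exact: differentiableD.
rewrite big_cons -IH2.
exact: (congr1 (fun F : V -> W => F v) (diffD (hf i) IH1)).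
Qed.

Lemma diff_line V (v a : V) (t : R) :
  differentiable (fun s : R => s *: v + a) t /\
  'd (fun s : R => s *: v + a) t 1 = v.
Proof.
have ds : differentiable ( *:%R^~ v : R -> V) t by [].
have dc : differentiable (cst a : R -> V) t by exact: differentiable_cst.
split; first exact: differentiableD.
apply: (etrans (congr1 (fun G : R -> V => G 1) (diffD ds dc))).
by rewrite /= diff_cst diff_val [_ + _]addr0 scale1r.
Qed.

(** Expanding the vector in the standard basis reduces the statement to the
    product rule for scalar multiples of partial derivatives. *)
Lemma diff_diff_apply n W (f : 'rV[R]_n -> W) (xi : 'rV[R]_n -> 'rV[R]_n) z w :
  smooth_near f z -> differentiable xi z ->
  differentiable (fun x => 'd f x (xi x)) z /\
  'd (fun x => 'd f x (xi x)) z w =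
    'd (fun x => 'd f x (xi z)) z w + 'd f z ('d xi z w).
Proof.
move=> sf dx.
have expand (u : 'rV[R]_n -> 'rV[R]_n) : (fun x => 'd f x (u x)) =
    (fun x => \sum_(i <- enum 'I_n) u x 0 i *: 'd f x (delta_mx 0 i)).
  apply/funext => x; rewrite big_enum/= [in LHS](row_sum_delta (u x)) linear_sum.
  by apply: eq_bigr => i _; rewrite linearZ.
have ddf i : differentiable (fun x => 'd f x (delta_mx 0 i)) z.
  by apply/smooth_differentiable/smooth_diff.
have key (u : 'rV[R]_n -> 'rV[R]_n) : differentiable u z ->
    differentiable (fun x => 'd f x (u x)) z /\
    'd (fun x => 'd f x (u x)) z w = \sum_i (u z 0 i *:
      'd (fun x => 'd f x (delta_mx 0 i)) z w + 'd u z w 0 i *: 'd f z (delta_mx 0 i)).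
  move=> du; have ds i := diff_scale (diff_entry 0 i w du).1 (ddf i).
  rewrite expand; have [d1 d2] := diff_big (enum 'I_n) (fun i => (ds i).1).
  split; first exact: d1.
  apply: (etrans (d2 w)); rewrite big_enum.
  apply: eq_bigr => i _.
  apply: (etrans ((ds i).2 w)); congr (_ + _ *: _).
  exact: (diff_entry 0 i w du).2.
have [d1 e1] := key _ dx; split; first exact: d1.
have [_ e2] := key _ (differentiable_cst (xi z) z).
apply: (etrans e1); rewrite big_split; congr (_ + _).
  apply: etrans (esym e2); rewrite big_split [X in _ = _ + X]big1 ?addr0// => i _.
  by rewrite diff_cst mxE scale0r.
rewrite [in RHS](row_sum_delta ('d xi z w)) linear_sum.
by apply: eq_bigr => i _; rewrite linearZ.
Qed.

Lemma diff_row_mx V p q (f : V -> 'rV[R]_p) (g : V -> 'rV[R]_q) z :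
  differentiable f z -> differentiable g z ->
  differentiable (fun u => row_mx (f u) (g u)) z /\
  forall v, 'd (fun u => row_mx (f u) (g u)) z v = row_mx ('d f z v) ('d g z v).
Proof.
move=> df dg.
pose L1 : {linear 'rV[R]_p -> 'rV[R]_(p + q)} := mulmxr (row_mx 1%:M 0).
pose L2 : {linear 'rV[R]_q -> 'rV[R]_(p + q)} := mulmxr (row_mx 0 1%:M).
have rE a b : row_mx a b = L1 a + L2 b.
  by rewrite /L1 /L2 /= !mul_mx_row !mulmx1 !mulmx0 add_row_mx addr0 add0r.
have -> : (fun u => row_mx (f u) (g u)) = (fun u => (L1 \o f) u + (L2 \o g) u).
  by apply/funext => u; rewrite rE.
have c1 : continuous L1 by exact: linear_mx_continuous.
have c2 : continuous L2 by exact: linear_mx_continuous.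
have [d1 _] := diff_lin_comp 0 c1 df; have [d2 _] := diff_lin_comp 0 c2 dg.
have [dA EA] := diff_add d1 d2.
split; [exact: dA|move=> v; rewrite rE; apply: (etrans (EA v))].
by apply: congr2; [exact: (diff_lin_comp v c1 df).2|exact: (diff_lin_comp v c2 dg).2].
Qed.

Lemma diff_mulmx V p q (f : V -> 'rV[R]_p) (g : V -> 'M[R]_(p, q)) z :
  differentiable f z -> differentiable g z ->
  differentiable (fun u => f u *m g u) z /\
  forall v, 'd (fun u => f u *m g u) z v = 'd f z v *m g z + f z *m 'd g z v.
Proof.
move=> df dg.
pose K i : {linear 'M[R]_(p, q) -> 'rV[R]_q} := row i.
have cK i : continuous (K i) by exact: linear_mx_continuous.
have dKg i := diff_lin_comp 0 (cK i) dg.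
have ds i := diff_scale (diff_entry 0 i 0 df).1 (dKg i).1.
have [dS ES] := diff_big (enum 'I_p) (fun i => (ds i).1).
have -> : (fun u => f u *m g u) =
    (fun u => \sum_(i <- enum 'I_p) f u 0 i *: (K i \o g) u).
  by apply/funext => u; rewrite big_enum mulmx_sum_row.
split; [exact: dS|move=> v; apply: (etrans (ES v))].
rewrite big_enum !mulmx_sum_row -big_split; apply: eq_bigr => i _.
apply: (etrans ((ds i).2 v)); rewrite addrC; apply: congr2.
  apply: congr2; [exact: (diff_entry 0 i v df).2|by []].
apply: congr2; [by []|exact: (diff_lin_comp v (cK i) dg).2].
Qed.

End LocalSmoothness.

(** * Symmetry of second derivatives *)

Section Schwarz.
Context {R : realType} {V : normedModType R}.

Lemma is_derive_line (f : V -> R) (a u : V) (t : R) :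
  differentiable f (t *: u + a) ->
  is_derive t 1 (fun s => f (s *: u + a)) ('d f (t *: u + a) u).
Proof.
move=> df.
have [dl El] := diff_line u a t.
have dc : differentiable (f \o (fun s : R => s *: u + a)) t.
  by apply: differentiable_comp.
apply: DeriveDef; first exact: diff_derivable.
apply: (etrans (deriveE _ dc)).
apply: (etrans (congr1 (fun G : R -> R => G 1) (diff_comp dl df))).
exact: (congr1 ('d f (t *: u + a)) El).
Qed.

Lemma diff_remainder (h : V -> R) z (e : R) : differentiable h z -> 0 < e ->
  exists2 d, 0 < d & forall w, `|w| < d ->
    `|h (w + z) - h z - 'd h z w| <= e * `|w|.
Proof.
move=> dh e0; have [_ H] := (diff_locallyP z h).1 dh.
have /eqaddoP/(_ e e0)/nbhs_normP[d d0 hd] := H; exists d => // w wd.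
have := hd w; rewrite /= !fctE /= => /(_ _).
by rewrite opprD addrA; apply; rewrite /ball_ /= sub0r normrN.
Qed.

Definition diff2 (f : V -> R) z u v (s : R) : R :=
  (f (s *: u + (s *: v + z)) - f (s *: u + z)) -
  (f (s *: v + z) - f z).

Lemma diff2_sym f z u v s : diff2 f z u v s = diff2 f z v u s.
Proof.
by rewrite /diff2 (addrCA (s *: u)); ring.
Qed.

(** By the mean value theorem [diff2] is [s] times a first-order difference of
    the derivative of [f] along [u], hence [s^2] times the mixed derivative up to
    an error that is small with respect to [s^2].  Since [diff2] is symmetric in
    [u] and [v], so is the mixed derivative. *)
Lemma diff2_approx (f : V -> R) z u v (e : R) :
  (\forall x \near z, differentiable f x) ->
  differentiable (fun x => 'd f x u) z -> 0 < e ->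
  exists2 d, 0 < d & forall s, 0 < s -> s < d ->
    `|diff2 f z u v s - s ^+ 2 * 'd (fun x => 'd f x u) z v| <= e * s ^+ 2.
Proof.
move=> df; set h := (fun x : V => 'd f x u) => dh e0.
(* all points involved are within [s * C] of [z]; the [1] makes [C] positive *)
pose C := `|u| + `|v| + 1.
have C0 : 0 < C by rewrite ltr_wpDl// addr_ge0.
have e'0 : 0 < e / (2 * C) by rewrite divr_gt0// mulr_gt0.
have [d1 d10 hd1] := diff_remainder dh e'0.
have [d2 /= d20 hd2] := (nbhs_normP _ _).1 df.
pose d := Num.min d1 d2.
have d0 : 0 < d by rewrite lt_min d10.
exists (d / C); first by rewrite divr_gt0.
move=> s s0 sd.
have sC : s * C < d by rewrite -ltr_pdivlMr.
have small c : 0 <= c -> c <= s -> `|c *: u + s *: v| <= s * C /\ `|c *: u| <= s * C.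
  move=> c0 cs.
  have cu : `|c *: u| <= s * `|u|.
    by rewrite normrZ (ger0_norm c0) ler_wpM2r.
  have sv : `|s *: v| = s * `|v| by rewrite normrZ (gtr0_norm s0).
  split.
    apply: (le_trans (ler_normD _ _)); rewrite sv.
    rewrite /C !mulrDr mulr1; apply: (@le_trans _ _ (s * `|u| + s * `|v|)).
      by rewrite lerD2r.
    by rewrite lerDl ltW.
  apply: (le_trans cu); rewrite ler_wpM2l ?(ltW s0)// /C -addrA lerDl.
  by rewrite addr_ge0.
have dfs c a : 0 <= c -> c <= s -> a = s *: v + z \/ a = z ->
    differentiable f (c *: u + a).
  move=> c0 cs; have [h1 h2] := small c c0 cs.
  have dd2 : d <= d2 by rewrite ge_min lexx orbT.
  case=> ->; apply: hd2; rewrite /= distrC.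
    by rewrite addrA addrK (le_lt_trans h1)// (lt_le_trans sC).
  by rewrite addrK (le_lt_trans h2)// (lt_le_trans sC).
pose g t : R := f (t *: u + (s *: v + z)) - f (t *: u + z).
pose g' t : R := h (t *: u + (s *: v + z)) - h (t *: u + z).
have gd t : 0 <= t -> t <= s -> is_derive t 1 g (g' t).
  move=> t0 ts; apply: is_deriveB; apply: is_derive_line; apply: dfs => //.
    by left.
  by right.
have [||c] := @MVT R g g' 0 s s0.
- by move=> x; rewrite in_itv/= => /andP[/ltW x0 /ltW xs]; exact: gd.
- apply: derivable_within_continuous => x; rewrite in_itv/= => /andP[x0 xs].
  by have [] := gd x x0 xs.
rewrite in_itv/= => /andP[/ltW c0 /ltW cs].
rewrite subr0 => E.
have -> : diff2 f z u v s = g' c * s.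
  by rewrite -E /diff2 /g !scale0r !add0r.
have [h1 h2] := small c c0 cs.
have dd1 : d <= d1 by rewrite ge_min lexx.
have r1 := hd1 _ (le_lt_trans h1 (lt_le_trans sC dd1)).
have r2 := hd1 _ (le_lt_trans h2 (lt_le_trans sC dd1)).
have L : 'd h z (c *: u + s *: v) = 'd h z (c *: u) + s * 'd h z v.
  by rewrite linearD [in X in _ + X]linearZ.
have -> : g' c * s - s ^+ 2 * 'd h z v =
  s * ((h (c *: u + s *: v + z) - h z - 'd h z (c *: u + s *: v)) -
       (h (c *: u + z) - h z - 'd h z (c *: u))).
  rewrite L /g' addrA; set a := h _; set b := h _; set k := h z.
  by rewrite expr2; ring.
rewrite normrM (gtr0_norm s0).
rewrite expr2 mulrCA ler_wpM2l ?(ltW s0)//.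
apply: (le_trans (ler_normB _ _)).
apply: (le_trans (lerD r1 r2)).
have -> : e * s = e / (2 * C) * (s * C) + e / (2 * C) * (s * C).
  by field; rewrite gt_eqF.
by apply: lerD; rewrite ler_wpM2l// ltW.
Qed.

Lemma schwarz_scalar (f : V -> R) z u v : smooth_near f z ->
  'd (fun x => 'd f x u) z v = 'd (fun x => 'd f x v) z u.
Proof.
move=> sf; have dfn : \forall x \near z, differentiable f x.
  by apply: filterS (smooth_near_near sf) => x; exact: smooth_differentiable.
have dh w : differentiable (fun x => 'd f x w) z.
  exact/smooth_differentiable/smooth_diff.
set a := LHS; set b := RHS.
apply/eqP; rewrite -subr_eq0 -normr_le0; apply/ler_addgt0Pl => e e0; rewrite addr0.
have e20 : 0 < e / 2 by rewrite divr_gt0.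
have [d1 d10 h1] := diff2_approx v dfn (dh u) e20.
have [d2 d20 h2] := diff2_approx u dfn (dh v) e20.
pose s := Num.min d1 d2 / 2.
have m0 : 0 < Num.min d1 d2 by rewrite lt_min d10.
have s0 : 0 < s by rewrite divr_gt0.
have sm : s < Num.min d1 d2 by rewrite ltr_pdivrMr// ltr_pMr// ltr1n.
have := h1 s s0 (lt_le_trans sm _); rewrite ge_min lexx => /(_ isT) r1.
have := h2 s s0 (lt_le_trans sm _); rewrite ge_min lexx orbT => /(_ isT) r2.
have s20 : 0 < s ^+ 2 by rewrite exprn_gt0.
rewrite -(ler_pM2l s20) -[X in X * _ <= _](gtr0_norm s20) -normrM.
move: r1 r2; rewrite -/a -/b (diff2_sym f z v u); set D := diff2 _ _ _ _ _ => r1 r2.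
have -> : s ^+ 2 * (a - b) = (D - s ^+ 2 * b) - (D - s ^+ 2 * a) by ring.
apply: (le_trans (ler_normB _ _)); apply: (le_trans (lerD r2 r1)).
by rewrite -mulrDl -splitr mulrC.
Qed.

Lemma schwarz n (f : V -> 'rV[R]_n) z u v : smooth_near f z ->
  'd (fun x => 'd f x u) z v = 'd (fun x => 'd f x v) z u.
Proof.
move=> sf; apply/rowP => i.
have key w w' : 'd (fun x => 'd f x w) z w' 0 i =
    'd (fun x => 'd (fun y => f y 0 i : R) x w) z w'.
  have dw : differentiable (fun x => 'd f x w) z.
    exact/smooth_differentiable/smooth_diff.
  have [dLw E] := diff_entry 0 i w' dw.
  apply: (etrans (esym E)); apply: esym.
  apply: near_eq_diff dLw.
  apply: filterS (smooth_near_near sf) => x /smooth_differentiable dx.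
  by apply: esym; exact: (diff_entry 0 i w dx).2.
apply: (etrans (key u v)); apply: etrans (esym (key v u)).
exact/schwarz_scalar/smooth_coord.
Qed.

End Schwarz.

(** * Bump functions on row vectors *)

Section Bump.
Context {R : realType}.

(** Besides the classical flat function [exp(-1/t)] the family contains the
    derivatives of all its members, which makes the induction on the order of
    differentiability possible. *)
Definition flat (p : {poly R}) (t : R) : R :=
  if 0 < t then p.[t^-1] * expR (- t^-1) else 0.

(** By the chain rule the derivative of [p(1/t) exp(-1/t)] is
    [t^-2 (p - p')(1/t) exp(-1/t)]. *)
Definition dflat (p : {poly R}) : {poly R} := 'X^2 * (p - p^`()).

(** The bound [1 + y <= exp y] at [y = x / n], raised to the power [n]. *)
Lemma pow_expR_bounded (n : nat) (x : R) : 0 < x ->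
  x ^+ n * expR (- x) <= n%:R ^+ n.
Proof.
case: n => [|n] x0.
  by rewrite !expr0 mul1r -expR0 ler_expR oppr_le0 ltW.
rewrite expRN ler_pdivrMr ?expR_gt0//.
have -> : x = n.+1%:R * (x / n.+1%:R) by rewrite mulrC divfK.
rewrite expRM_natl exprMn ler_wpM2l ?exprn_ge0//.
rewrite lerXn2r ?nnegrE ?expR_ge0 ?divr_ge0 ?(ltW x0)//.
by apply: le_trans (expR_ge1Dx _); rewrite lerDr.
Qed.

Lemma poly_expR_bounded (p : {poly R}) :
  exists C, forall x, 0 < x -> `|p.[x] * expR (- x)| <= C.
Proof.
exists (\sum_(i < size p) `|p`_i| * i%:R ^+ i) => x x0.
rewrite horner_coef mulr_suml; apply: (le_trans (ler_norm_sum _ _ _)).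
apply: ler_sum => i _.
rewrite -mulrA normrM ler_wpM2l// ger0_norm; first exact: pow_expR_bounded.
by rewrite mulr_ge0 ?expR_ge0 ?exprn_ge0// ltW.
Qed.

(** The bound of the previous lemma for [X^2 p], read at [1/t]. *)
Lemma flat_sqr_bounded (p : {poly R}) : exists2 C, 0 < C &
  forall t, `|flat p t| <= C * t ^+ 2.
Proof.
have [C hC] := poly_expR_bounded ('X^2 * p).
exists (`|C| + 1); first by rewrite ltr_wpDl.
move=> t; rewrite /flat; case: ifPn => [t0|_]; last first.
  by rewrite normr0 mulr_ge0// ?addr_ge0// sqr_ge0.
have := hC t^-1; rewrite invr_gt0 => /(_ t0).
rewrite hornerM hornerXn -mulrA normrM ger0_norm ?exprn_ge0 ?invr_ge0 ?(ltW t0)//.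
rewrite exprVn ler_pdivrMl ?exprn_gt0// mulrC => /le_trans; apply.
by rewrite mulrC ler_wpM2r ?sqr_ge0// (le_trans (ler_norm _))// lerDl.
Qed.

(** Near [0] the functions [flat p] are [O(t^2)], which is all that their
    differentiability there requires; elsewhere they are elementary.  The
    family is closed under differentiation, hence consists of smooth
    functions. *)
Lemma flat_derive (p : {poly R}) (t : R) :
  is_derive t 1 (flat p) (flat (dflat p) t).
Proof.
have [t0|t0|<-] := ltgtP 0 t.
- pose g (s : R) : R := p.[s^-1] * expR (- s^-1).
  have gt : is_derive t 1 g (flat (dflat p) t).
    have dinv := @is_deriveV R id t 1 1 (lt0r_neq0 t0) (is_derive_id _ _).
    have dp := @is_derive1_comp R (horner p) (fun s => s^-1) t _ _
      (is_derive_poly p _) dinv.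
    have dm := @is_deriveN R R R^o (fun s => s^-1) t 1 _ dinv.
    have de := @is_derive1_comp R expR (fun s => - s^-1) t _ _ (is_derive_expR _) dm.
    apply: (is_derive_eq (is_deriveM dp de)).
    rewrite /flat t0 /dflat hornerM hornerXn hornerD hornerN /=.
    rewrite exprVn [_ *: 1]mulr1 -[_ *: _]/(_ * _) -[X in _ + X]/(_ * _).
    by ring.
  apply: near_eq_is_derive gt; near=> s.
  rewrite /flat /g ifT//; near: s; exact: lt_nbhsr.
- have -> : flat (dflat p) t = 0 by rewrite /flat ltNge (ltW t0).
  apply: (@near_eq_is_derive R R R^o (cst 0)).
  near=> s; rewrite /flat ifF//; apply/negbTE; rewrite -leNgt ltW//.
  by near: s; exact: lt_nbhsl.
have -> : flat (dflat p) 0 = 0 by rewrite /flat ltxx.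
have [C C0 hC] := flat_sqr_bounded p.
have H : (fun h => h^-1 *: ((flat p \o shift 0) (h *: 1) - flat p 0)) @ 0^' --> (0 : R).
  apply/cvgrPdist_le => e e0; near=> h.
  have h0 : h != 0 by near: h; exact: nbhs_dnbhs_neq.
  rewrite /= sub0r normrN addr0 [h *: 1]mulr1 {2}/flat ltxx subr0.
  rewrite normrZ normfV ler_pdivrMl ?normr_gt0// (le_trans (hC h))//.
  rewrite -real_normK ?num_real// expr2 mulrCA ler_wpM2l//.
  rewrite -ler_pdivlMl//; near: h.
  by apply: dnbhs0_le; rewrite mulr_gt0 ?invr_gt0.
apply: DeriveDef; first by apply/cvg_ex; exists 0.
exact/cvg_lim.
Unshelve. all: by end_near. Qed.

Lemma flat_smooth (p : {poly R}) (t : R) : smooth_near (flat p) t.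
Proof.
exists setT; first by split => //; exact: openT.
move=> k; elim: k p => [|k IH] p.
  move=> z _; apply: differentiable_continuous.
  by apply/derivable1_diffP; have [] := flat_derive p z.
split=> [z _|v].
  by apply/derivable1_diffP; have [] := flat_derive p z.
apply: (@eq_Ck _ _ _ _ _ (fun z => v *: flat (dflat p) z)); first exact: openT.
  move=> z _; have dz : derivable (flat p) z 1 by have [] := flat_derive p z.
  rewrite (deriv1E dz) derive1E.
  by have [_ ->] := flat_derive p z.
apply: Ck_scale; [exact: openT|exact: Ck_cst|exact: IH].
Qed.

(** The function [psi(r^2 - |z - z0|^2)], with [psi] flat at [0] and the
    Euclidean norm, is smooth and carried by a product of intervals, which is
    compact. *)
Lemma bump_rV n (U : set 'rV[R]_n) (z0 : 'rV[R]_n) : nbhs z0 U ->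
  exists b : 'rV[R]_n -> R, exists2 K, compact K /\ K `<=` U &
    [/\ b z0 = 1, (forall z, smooth_near b z) & forall z, ~ K z -> b z = 0].
Proof.
case/nbhs_ballP => e /= e0 eU; pose r := e / 2.
have r0 : 0 < r by rewrite divr_gt0.
pose q (z : 'rV[R]_n) : R :=
  r ^+ 2 + \sum_(i <- enum 'I_n) (z0 0 i - z 0 i) *: (z 0 i - z0 0 i).
pose b z := (flat 1 (q z0))^-1 *: (flat 1 (q z) : R).
exists b, [set z | forall i, `[z0 0 i - r, z0 0 i + r]%classic (z 0 i)].
  split.
    apply: (@rV_compact R n (fun i => `[z0 0 i - r, z0 0 i + r]%classic)).
    by move=> i; exact: segment_compact.
  move=> z Kz; apply: eU; split=> // i j; rewrite ord1 /=.
  have := Kz j; rewrite /= in_itv /= lerBlDr => /andP[h1 h2].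
  rewrite /ball /= (@le_lt_trans _ _ r)// ?ltr_pdivrMr// ?ltr_pMr ?ltr1n//.
  by rewrite ler_norml; apply/andP; split; lra.
have q0 : q z0 = r ^+ 2.
  rewrite /q big1_seq ?addr0// => i _; by rewrite subrr scale0r.
split.
- rewrite /b -[_ *: _]/(_ * _) mulVf// q0 /flat exprn_gt0// hornerC mul1r.
  by rewrite gt_eqF// expR_gt0.
- move=> z; apply: smooth_scale; first exact: smooth_cst.
  apply: (@smooth_compR _ _ _ q (flat 1)); last exact: flat_smooth.
  apply: smoothD; first exact: smooth_cst.
  have sc i c : smooth_near (fun x : 'rV[R]_n => x 0 i + c : R) z.
    by apply: smoothD; [exact/smooth_coord/smooth_id|exact: smooth_cst].
  apply: smooth_sum => i; apply: smooth_scale; last exact: sc.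
  have := smooth_scale (smooth_cst (-1 : R) z) (sc i (- z0 0 i)).
  by apply: near_eq_smooth; near=> x; rewrite /cst scaleN1r opprB.
move=> z; apply: contra_notP => /eqP bz i.
have : 0 < q z.
  by apply: contraNT bz => qz; rewrite /b {2}/flat ifN// scaler0.
rewrite /q big_enum (bigD1 i)//= -[_ *: _]/(_ * _); set S := \sum_(_ | _) _.
have S0 : S <= 0.
  apply: sumr_le0 => j _; rewrite -[_ *: _]/(_ * _) -opprB mulNr oppr_le0.
  by rewrite -expr2 sqr_ge0.
move=> qz; rewrite in_itv /=.
have : (z 0 i - z0 0 i) ^+ 2 <= r ^+ 2 by rewrite expr2; lra.
rewrite -ler_sqrt ?sqr_ge0// !sqrtr_sqr (gtr0_norm r0) ler_norml => /andP[h1 h2].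
by apply/andP; split; lra.
Unshelve. all: by end_near. Qed.

End Bump.

(** * Changes of chart, brackets and tangent maps *)

Section ChartCalculus.
Context {R : realType} {n : nat} {T : choiceType}.
Variable A : manifold R n T.
Notation TA := (atlas_space (atlas A)).
Implicit Types c d e : chart (R := R) n T.

Lemma atlas_max c : atlas A c -> max_atlas A c.
Proof.
move=> Ac; split; first exact: (atlas_chart Ac).
by move=> d Ad; exact: (atlas_compatible Ac Ad).
Qed.

Lemma max_chart_at p : max_atlas A (chart_at A p).
Proof. exact/atlas_max/chart_at_atlas. Qed.

Lemma cinvK c p : max_atlas A c -> cdom c p -> cinv c (c p) = p.
Proof. by case=> -[_ h] _; exact: h. Qed.

Lemma transition_smooth c d p : compatible c d -> cdom c p -> cdom d p ->
  smooth_near (d \o cinv c) (c p).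
Proof. by case=> -[oi si] _ cp dp; apply: (smooth_on_near oi si); exists p. Qed.

Lemma transition_image c d p : compatible c d -> cdom c p -> cdom d p ->
  \forall z \near c p, exists2 q, cdom c q /\ cdom d q & z = c q.
Proof.
case=> -[oi _] _ cp dp.
have : nbhs (c p) (c @` (cdom c `&` cdom d)) by apply: open_nbhs_nbhs; split=> //; exists p.
by apply: filterS => z [q qd <-]; exists q.
Qed.

(** The topology is defined by the charts of the atlas; those of the maximal
    atlas see the same neighbourhoods because transition maps are continuous. *)
Lemma near_chart c p (P : set T) : max_atlas A c -> cdom c p ->
  nbhs (p : TA) P <-> \forall z \near c p, P (cinv c z).
Proof.
move=> mc cp; have [[oc ck] cc] := mc; split.
  case/near_open => U [oU Up] UP.
  have aU : @atlas_open R n T (atlas A) U by exact: oU.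
  pose a := chart_at A p; have Aa : atlas A a by exact: chart_at_atlas.
  have ap : cdom a p by exact: chart_at_dom.
  have h := aU a p Aa ap Up.
  have sm := smooth_continuous (transition_smooth (cc _ Aa) cp ap).
  have {h} h : \forall z \near c p, U (cinv a (a (cinv c z))).
    apply: (sm (fun w => U (cinv a w))).
    by rewrite /= cinvK.
  have im := transition_image (cc _ Aa) cp ap.
  apply: filterS2 h im => z hU [q [cq aq] zE].
  by apply: UP; move: hU; rewrite zE (ck q cq) cinvK//; exact: atlas_max.
move=> h.
have im : nbhs (c p) (cimg c) by apply: open_nbhs_nbhs; split=> //; exists p.
have [V [oV Vp] VP] := near_open (filterI h im).
rewrite nbhsE; exists [set u | cdom c u /\ V (c u)].
  split; last by [].
  have : @atlas_open R n T (atlas A) [set u | cdom c u /\ V (c u)]; last by [].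
  move=> d q Ad dq [cq Vq].
  have cd := cc _ Ad; have dc : compatible d c by case: cd.
  have sm := smooth_continuous (transition_smooth dc dq cq).
  have hV : \forall z \near d q, V (c (cinv d z)).
    apply: (sm V); rewrite /= cinvK//; last exact: atlas_max.
    exact: open_nbhs_nbhs.
  apply: filterS2 hV (transition_image dc dq cq) => z Vz [r [dr cr] zE].
  by split=> //; rewrite zE cinvK//; exact: atlas_max.
by move=> u [cu Vu]; have [Pu _] := VP _ Vu; rewrite -(ck u cu).
Qed.

Lemma near_cdom c p : max_atlas A c -> cdom c p -> nbhs (p : TA) (cdom c).
Proof.
move=> mc cp; apply/(near_chart _ mc cp); have [[oc ck] _] := mc.
have : nbhs (c p) (cimg c) by apply: open_nbhs_nbhs; split=> //; exists p.
by apply: filterS => z [q cq <-]; rewrite ck.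
Qed.

Lemma near_cimg c p : max_atlas A c -> cdom c p -> nbhs (c p) (cimg c).
Proof. by case=> -[oc _] _ cp; apply: open_nbhs_nbhs; split=> //; exists p. Qed.

Lemma near_chartP c p (P : set T) : max_atlas A c -> cdom c p ->
  nbhs (p : TA) P -> \forall z \near c p, [/\ P (cinv c z), cdom c (cinv c z) &
    c (cinv c z) = z].
Proof.
move=> mc cp /(near_chart _ mc cp) h.
apply: filterS2 h (near_cimg mc cp) => z Pz [q cq zE].
by rewrite -zE cinvK in Pz *.
Qed.

(** Charts of the maximal atlas are only known to be compatible with the charts of
    the atlas; their transition map factors near the point through one of those. *)
Lemma transition_max c d p : max_atlas A c -> max_atlas A d ->
  cdom c p -> cdom d p -> smooth_near (d \o cinv c) (c p).
Proof.
move=> mc md cp dp; pose a := chart_at A p.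
have Aa : atlas A a by exact: chart_at_atlas.
have ap : cdom a p by exact: chart_at_dom.
have ma := atlas_max Aa.
have sca : smooth_near (a \o cinv c) (c p).
  by apply: transition_smooth => //; case: mc => _; apply.
have sad : smooth_near (d \o cinv a) ((a \o cinv c) (c p)).
  rewrite /= cinvK//; apply: transition_smooth => //.
  by case: md => _ /(_ a Aa) [].
have := smooth_comp sca sad; apply: near_eq_smooth.
apply: filterS (near_chartP mc cp (near_cdom ma ap)) => z [az _ _] /=.
by rewrite cinvK.
Qed.

Section ChangeOfChart.
Variables (W : normedModType R) (f : T -> W) (c d : chart (R := R) n T) (p : T).
Hypotheses (mc : max_atlas A c) (md : max_atlas A d) (cp : cdom c p) (dp : cdom d p).

Lemma near_change : {near d p, (f \o cinv c) \o (c \o cinv d) =1 f \o cinv d}.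
Proof.
apply: filterS (near_chartP md dp (near_cdom mc cp)) => z [cz _ _] /=.
by rewrite cinvK.
Qed.

Lemma change_smooth :
  smooth_near (f \o cinv c) (c p) -> smooth_near (f \o cinv d) (d p).
Proof.
move=> sf; apply: (near_eq_smooth near_change).
apply: smooth_comp; first exact: transition_max.
by rewrite /= cinvK.
Qed.

Lemma change_diff : differentiable (f \o cinv c) (c p) ->
  differentiable (f \o cinv d) (d p) /\
  forall v, 'd (f \o cinv d) (d p) v =
    'd (f \o cinv c) (c p) ('d (c \o cinv d) (d p) v).
Proof.
move=> df.
have dt : differentiable (c \o cinv d) (d p).
  exact/smooth_differentiable/transition_max.
have df' : differentiable (f \o cinv c) ((c \o cinv d) (d p)) by rewrite /= cinvK.
have dc := differentiable_comp dt df'.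
have [h1 h2] := near_eq_differentiable near_change dc.
split; [exact: h1|move=> v]; apply: (etrans (congr1 (fun F : _ -> W => F v) h2)).
apply: (etrans (congr1 (fun F : _ -> W => F v) (diff_comp dt df'))).
by rewrite /= cinvK.
Qed.

End ChangeOfChart.

(** The Jacobian of the change of coordinates from [c] to [d]. *)
Definition jac c d (p : T) (v : 'rV[R]_n) : 'rV[R]_n := 'd (d \o cinv c) (c p) v.

Lemma tcoordE c p v : tcoord A c p v = jac (chart_at A p) c p v.
Proof. by []. Qed.

Lemma tvecE c p v : tvec A c p v = jac c (chart_at A p) p v.
Proof. by []. Qed.

Lemma jac_linear c d p : linear (jac c d p).
Proof. by move=> a u v; rewrite /jac linearP. Qed.

Lemma jacB c d p u v : jac c d p (u - v) = jac c d p u - jac c d p v.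
Proof. exact: linearB. Qed.

Lemma jac_comp c d e p v : max_atlas A c -> max_atlas A d -> max_atlas A e ->
  cdom c p -> cdom d p -> cdom e p -> jac d e p (jac c d p v) = jac c e p v.
Proof.
move=> mc md me cp dp ep.
have de : differentiable (e \o cinv d) (d p).
  exact/smooth_differentiable/transition_max.
by have [_ h] := change_diff md mc dp cp de; exact: (esym (h v)).
Qed.

Lemma jac_id c p v : max_atlas A c -> cdom c p -> jac c c p v = v.
Proof.
move=> mc cp.
have idn : {near c p, id =1 c \o cinv c}.
  by apply: filterS (near_chartP mc cp (near_cdom mc cp)) => z [_ _] /=.
apply: (etrans (near_eq_diff v idn _)); first exact/smooth_differentiable/smooth_id.
by rewrite diff_val.
Qed.

Lemma jacK c d p v : max_atlas A c -> max_atlas A d ->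
  cdom c p -> cdom d p -> jac d c p (jac c d p v) = v.
Proof. by move=> mc md cp dp; rewrite jac_comp// jac_id. Qed.

Lemma tvecK c p v : max_atlas A c -> cdom c p -> tcoord A c p (tvec A c p v) = v.
Proof.
move=> mc cp; rewrite tcoordE tvecE jacK//; first exact: max_chart_at.
exact: chart_at_dom.
Qed.

Lemma tcoordK c p v : max_atlas A c -> cdom c p -> tvec A c p (tcoord A c p v) = v.
Proof.
move=> mc cp; rewrite tcoordE tvecE jacK//; first exact: max_chart_at.
exact: chart_at_dom.
Qed.

Lemma tcoord_linear c p : linear (tcoord A c p).
Proof. exact: jac_linear. Qed.

Lemma tvec_linear c p : linear (tvec A c p).
Proof. exact: jac_linear. Qed.

Lemma jac_tcoord c d p v : max_atlas A c -> max_atlas A d ->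
  cdom c p -> cdom d p -> jac c d p (tcoord A c p v) = tcoord A d p v.
Proof.
move=> mc md cp dp; rewrite !tcoordE jac_comp//; first exact: max_chart_at.
exact: chart_at_dom.
Qed.

Lemma tcoord_chart_at p v : tcoord A (chart_at A p) p v = v.
Proof. by rewrite tcoordE jac_id//; [exact: max_chart_at|exact: chart_at_dom]. Qed.

Lemma vrepE c (X : T -> 'rV[R]_n) :
  vrep A c X = (fun u => tcoord A c u (X u)) \o cinv c.
Proof. by []. Qed.

Lemma near_vrep c d p (X : T -> 'rV[R]_n) : max_atlas A c -> max_atlas A d ->
  cdom c p -> cdom d p ->
  {near c p, (fun z => 'd (d \o cinv c) z (vrep A c X z)) =1
     (fun u => tcoord A d u (X u)) \o cinv c}.
Proof.
move=> mc md cp dp.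
apply: filterS (near_chartP mc cp (near_cdom md dp)) => z [dz cz zE] /=.
by rewrite -(jac_tcoord (X (cinv c z)) mc md cz dz) /jac zE.
Qed.

Lemma vrep_smooth c d p (X : T -> 'rV[R]_n) : max_atlas A c -> max_atlas A d ->
  cdom c p -> cdom d p ->
  smooth_near (vrep A c X) (c p) -> smooth_near (vrep A d X) (d p).
Proof.
move=> mc md cp dp sX; rewrite vrepE; apply: (change_smooth mc md cp dp).
apply: near_eq_smooth (near_vrep X mc md cp dp) _.
by apply: smooth_diff_apply => //; exact: transition_max.
Qed.

(** Differentiating [Z_d = J Z_c], with [J] the Jacobian of the transition map,
    produces a second derivative of the transition map besides the transform of
    the derivative of [Z_c]. *)
Lemma vrep_diff c d p (X : T -> 'rV[R]_n) : max_atlas A c -> max_atlas A d ->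
  cdom c p -> cdom d p -> differentiable (vrep A c X) (c p) ->
  differentiable (vrep A d X) (d p) /\
  forall w, 'd (vrep A d X) (d p) (jac c d p w) =
    'd (fun z => 'd (d \o cinv c) z (vrep A c X (c p))) (c p) w +
    jac c d p ('d (vrep A c X) (c p) w).
Proof.
move=> mc md cp dp dX.
have st := transition_max mc md cp dp.
have [dF EF] := diff_diff_apply (c p) st dX.
have [dG EG] := near_eq_differentiable (near_vrep X mc md cp dp) dF.
have [dH _] := change_diff mc md cp dp dG.
have [_ EH] := change_diff md mc dp cp dH.
split; [exact: dH|move=> w].
apply: (etrans (esym (EH w))).
apply: (etrans (congr1 (fun F : _ -> 'rV[R]_n => F w) EG)).
exact: (diff_diff_apply w st dX).2.
Qed.

(** The bracket does not depend on the chart: the terms in which the two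
    formulas differ are second derivatives of the transition map, which cancel
    by symmetry. *)
Lemma bracket_chart d p (X Y : T -> 'rV[R]_n) : max_atlas A d -> cdom d p ->
  differentiable (vrep A d X) (d p) -> differentiable (vrep A d Y) (d p) ->
  tcoord A d p (bracket A X Y p) =
  'd (vrep A d Y) (d p) (vrep A d X (d p)) -
  'd (vrep A d X) (d p) (vrep A d Y (d p)).
Proof.
move=> md dp dX' dY'; set c := chart_at A p.
have mc : max_atlas A c by exact: max_chart_at.
have cp : cdom c p by exact: chart_at_dom.
have [dX _] := vrep_diff md mc dp cp dX'.
have [dY _] := vrep_diff md mc dp cp dY'.
have [_ EX] := vrep_diff mc md cp dp dX.
have [_ EY] := vrep_diff mc md cp dp dY.
have vX Z : vrep A c Z (c p) = Z p by rewrite /vrep cinvK// tcoord_chart_at.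
have vd Z : vrep A d Z (d p) = jac c d p (Z p) by rewrite /vrep cinvK.
rewrite (vd X) (vd Y).
have st := transition_max mc md cp dp.
have S := schwarz (X p) (Y p) st.
rewrite tcoordE /bracket -/c.
apply: (etrans (jacB _ _ _ _ _)).
pose D Z w w' := 'd (fun z => 'd (d \o cinv c) z Z) (c p) w + w'.
have E Z w : 'd (vrep A d Z) (d p) (jac c d p w) =
    D (vrep A c Z (c p)) w (jac c d p ('d (vrep A c Z) (c p) w)) -> 
  'd (vrep A d Z) (d p) (jac c d p w) =
    D (Z p) w (jac c d p ('d (vrep A c Z) (c p) w)) by rewrite vX.
have E1 := E Y (X p) (EY (X p)); have E2 := E X (Y p) (EX (Y p)).
apply: esym; apply: (etrans (congr2 (fun a b => a - b) E1 E2)).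
have cancel (t a b : 'rV[R]_n) : (t + a) - (t + b) = a - b.
  by rewrite opprD addrACA subrr add0r.
exact: (etrans (congr1 (fun s => D (Y p) (X p) _ - (s + _)) S) (cancel _ _ _)).
Qed.

(** Extension by zero outside the chart is smooth because the support is the
    image of a compact set, hence closed in the manifold, which is separated. *)
Lemma bump_manifold e p : max_atlas A e -> cdom e p ->
  exists b : T -> R, [/\ b p = 1,
    (forall c q, max_atlas A c -> cdom c q -> smooth_near (b \o cinv c) (c q)) &
    forall q, ~ cdom e q -> nbhs (q : TA) [set u | b u = 0]].
Proof.
move=> me ep; have [[oe ek] _] := me.
have [b0 [K [cK Ke] [b0p sb b0K]]] := bump_rV (near_cimg me ep).
pose b u := if u \in cdom e then b0 (e u) else 0.
have bE u : cdom e u -> b u = b0 (e u) by move=> eu; rewrite /b mem_set.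
have cK' : compact (cinv e @` K : set TA).
  apply: continuous_compact => //; apply: continuous_in_subspaceT => z /set_mem Kz.
  have [q eq zE] := Ke z Kz; rewrite -zE => P.
  by rewrite /= (ek q eq) => /(near_chart _ me eq).
have clK : closed (cinv e @` K : set TA).
  exact: (compact_closed (@manifold_hausdorff _ _ _ A)).
have away q : ~ cdom e q -> nbhs (q : TA) [set u | b u = 0].
  move=> eq; have : nbhs (q : TA) (~` (cinv e @` K)).
    apply: open_nbhs_nbhs; split; first exact: closed_openC.
    by move=> [z Kz zE]; apply: eq; have [r er rE] := Ke z Kz; rewrite -zE -rE ek.
  apply: filterS => u Ku /=; rewrite /b; case: ifPn => // /set_mem eu.
  by apply: b0K => Keu; apply: Ku; exists (e u) => //; exact: ek.
exists b; split=> //; first by rewrite bE.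
move=> c q mc cq; have [eq|neq] := pselect (cdom e q).
  apply: (change_smooth me mc eq cq).
  apply: near_eq_smooth (sb (e q)).
  apply: filterS (near_chartP me eq (near_cdom me eq)) => z [_ ez zE] /=.
  by rewrite bE// zE.
have s0 : smooth_near (cst (0 : R)) (c q) by exact: smooth_cst.
apply: near_eq_smooth s0.
by apply: filterS (near_chartP mc cq (away _ neq)) => z [/= bz _ _].
Qed.

End ChartCalculus.

Section MapsInCharts.
Context {R : realType} {n n' : nat} {T T' : choiceType}.
Variables (A : manifold R n T) (B : manifold R n' T') (f : T -> T').
Notation TA := (atlas_space (atlas A)).
Notation TB := (atlas_space (atlas B)).

(** A map is continuous at a point as soon as its coordinate expression is. *)
Lemma near_image (c : chart n T) (d : chart n' T') p (P : set T') :
  max_atlas A c -> max_atlas B d -> cdom c p -> cdom d (f p) ->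
  nbhs (p : TA) (cdom d \o f) -> {for c p, continuous (d \o f \o cinv c)} ->
  nbhs (f p : TB) P -> nbhs (p : TA) (P \o f).
Proof.
move=> mc md cp dp nd cont /(near_chart _ md dp) h.
apply/(near_chart _ mc cp).
have : \forall z \near c p, P (cinv d (d (f (cinv c z)))).
  by apply: (cont (fun w => P (cinv d w))); rewrite /= (cinvK mc cp).
move: nd => /(near_chart _ mc cp); apply: filterS2 => z dz.
by rewrite /= (cinvK md).
Qed.

(** Continuity is part of what has to be transported from one pair of charts to
    another, since it guarantees that the map takes values in the new chart. *)
Lemma map_smooth_change (c c' : chart n T) (d d' : chart n' T') p :
  max_atlas A c -> max_atlas B d -> cdom c p -> cdom d (f p) ->
  max_atlas A c' -> max_atlas B d' -> cdom c' p -> cdom d' (f p) ->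
  nbhs (p : TA) (cdom d \o f) -> smooth_near (d \o f \o cinv c) (c p) ->
  nbhs (p : TA) (cdom d' \o f) /\ smooth_near (d' \o f \o cinv c') (c' p).
Proof.
move=> mc md cp dp mc' md' cp' dp' nd sf.
have nd' : nbhs (p : TA) (cdom d' \o f).
  by apply: (near_image mc md cp dp nd (smooth_continuous sf)); exact: near_cdom.
split=> //.
have sf' := change_smooth mc mc' cp cp' sf.
have st : smooth_near (d' \o cinv d) ((d \o f \o cinv c') (c' p)).
  by rewrite /= (cinvK mc' cp'); exact: (transition_max md md').
apply: near_eq_smooth (smooth_comp sf' st).
move: nd => /(near_chart _ mc' cp'); apply: filterS => z dz.
by rewrite /= (cinvK md).
Qed.

Lemma smooth_map_at_chart (c : chart n T) (d : chart n' T') p :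
  max_atlas A c -> max_atlas B d -> cdom c p -> cdom d (f p) ->
  nbhs (p : TA) (cdom d \o f) -> smooth_near (d \o f \o cinv c) (c p) ->
  smooth_map_at A B f p.
Proof.
move=> mc md cp dp nd sf c' d' Ac Ad cp' dp'.
have mc' := atlas_max Ac; have md' := atlas_max Ad.
have [h1 h2] := map_smooth_change mc md cp dp mc' md' cp' dp' nd sf.
split; [exact: ((near_chart _ mc' cp').1 h1)|exact: h2].
Qed.

Lemma smooth_map_at_in_chart (c : chart n T) (d : chart n' T') p :
  max_atlas A c -> max_atlas B d -> cdom c p -> cdom d (f p) ->
  smooth_map_at A B f p ->
  nbhs (p : TA) (cdom d \o f) /\ smooth_near (d \o f \o cinv c) (c p).
Proof.
move=> mc md cp dp sf.
have Ac := chart_at_atlas A p; have Ad := chart_at_atlas B (f p).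
have cp' := chart_at_dom A p; have dp' := chart_at_dom B (f p).
have [h1 h2] := sf _ _ Ac Ad cp' dp'.
have mc' := atlas_max Ac; have md' := atlas_max Ad.
have nd : nbhs (p : TA) (cdom (chart_at B (f p)) \o f).
  exact: ((near_chart _ mc' cp').2 h1).
exact: (map_smooth_change mc' md' cp' dp' mc md cp dp nd h2).
Qed.

Lemma tmap_chart (c : chart n T) (d : chart n' T') p v :
  max_atlas A c -> max_atlas B d -> cdom c p -> cdom d (f p) ->
  nbhs (p : TA) (cdom d \o f) -> differentiable (d \o f \o cinv c) (c p) ->
  tcoord B d (f p) (tmap A B f p v) =
  'd (d \o f \o cinv c) (c p) (tcoord A c p v).
Proof.
move=> mc md cp dp nd df.
set c0 := chart_at A p; set d0 := chart_at B (f p).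
have mc0 : max_atlas A c0 by exact: max_chart_at.
have md0 : max_atlas B d0 by exact: max_chart_at.
have cp0 : cdom c0 p by exact: chart_at_dom.
have dp0 : cdom d0 (f p) by exact: chart_at_dom.
have [dg Eg] := change_diff mc mc0 cp cp0 df.
have g0 : (d \o f \o cinv c0) (c0 p) = d (f p) by rewrite /= (cinvK mc0 cp0).
have st : differentiable (d0 \o cinv d) ((d \o f \o cinv c0) (c0 p)).
  by rewrite g0; apply: smooth_differentiable; exact: (transition_max md md0).
have nE : {near c0 p, (d0 \o cinv d) \o (d \o f \o cinv c0) =1
    d0 \o f \o cinv c0}.
  move: nd => /(near_chart _ mc0 cp0); apply: filterS => z dz.
  by rewrite /= (cinvK md).
have E : tmap A B f p v = jac d d0 (f p) ('d (d \o f \o cinv c) (c p) (tcoord A c p v)).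
  apply: (etrans (near_eq_diff v nE (differentiable_comp dg st))).
  apply: (etrans (congr1 (fun F : _ -> 'rV[R]_n' => F v) (diff_comp dg st))).
  rewrite /jac -g0; apply: (congr1 ('d (d0 \o cinv d) ((d \o f \o cinv c0) (c0 p)))).
  exact: Eg.
apply: (etrans (congr1 (tcoord B d (f p)) E)).
rewrite tcoordE -/d0; exact: (jacK _ md md0).
Qed.

End MapsInCharts.

(** * Bundle coordinates *)

Section BundleChart.
Context {R : realType} {m k : nat} {M : choiceType}.
Variables (MM : manifold R m M) (F : M -> lmodType R).
Notation E := {p : M & F p}.
Variable EE : manifold R (m + k) E.
Variables (x : chart (R := R) m M) (e : chart (R := R) (m + k) E).
Hypothesis xe : bundle_chart MM EE x e.
Notation TM := (atlas_space (atlas MM)).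
Notation TE := (atlas_space (atlas EE)).

Lemma base_max : max_atlas MM x. Proof. by case: xe. Qed.
Lemma total_max : max_atlas EE e. Proof. by case: xe. Qed.

Lemma cdom_tag u : cdom e u <-> cdom x (tag u).
Proof. by case: xe => _ _ -> _ _. Qed.

Lemma chart_split u : cdom e u -> e u = row_mx (x (tag u)) (ycoord e u).
Proof. by case: xe => _ _ _ h _ eu; rewrite -(h u eu) hsubmxK. Qed.

Lemma ycoordP p (a : R) (w w' : F p) : cdom x p ->
  ycoord e (Tagged F (a *: w + w')) =
  a *: ycoord e (Tagged F w) + ycoord e (Tagged F w').
Proof. by case: xe => _ _ _ _ h /h; apply. Qed.

Lemma ycoord0 p : cdom x p -> ycoord e (Tagged F (0 : F p)) = 0.
Proof.
move=> xp; have := ycoordP (-1) 0 (0 : F p) xp.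
by rewrite scaler0 add0r scaleN1r addNr.
Qed.

Lemma ycoordZ p (a : R) (w : F p) : cdom x p ->
  ycoord e (Tagged F (a *: w)) = a *: ycoord e (Tagged F w).
Proof. by move=> xp; rewrite -[X in Tagged F X]addr0 ycoordP// ycoord0// addr0. Qed.

Lemma ycoord_inj p (w w' : F p) : cdom x p ->
  ycoord e (Tagged F w) = ycoord e (Tagged F w') -> w = w'.
Proof.
move=> xp yE; have [dw dw'] : cdom e (Tagged F w) /\ cdom e (Tagged F w').
  by split; exact/cdom_tag.
have eE : e (Tagged F w) = e (Tagged F w') by rewrite !chart_split// yE.
apply: (@eq_from_Tagged _ F).
by rewrite -(cinvK total_max dw) eE (cinvK total_max dw').
Qed.

(** Openness of the image of the chart makes the injective linear map given by
    the fibre coordinates surjective: it reaches a neighbourhood of zero. *)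
Lemma ycoord_surj p (eta : 'rV[R]_k) : cdom x p ->
  exists w : F p, ycoord e (Tagged F w) = eta.
Proof.
move=> xp; pose u0 := Tagged F (0 : F p).
have du0 : cdom e u0 by exact/cdom_tag.
have im := near_cimg total_max du0.
pose l (t : R) : 'rV[R]_(m + k) := e u0 + t *: row_mx 0 eta.
have cl : {for 0, continuous l}.
  apply: differentiable_continuous.
  have -> : l = (fun t => t *: row_mx 0 eta + e u0).
    by apply/funext => t; rewrite /l addrC.
  exact: (diff_line _ _ _).1.
have : \forall t \near (0 : R), cimg e (l t).
  by apply: (cl (cimg e)); rewrite /= /l scale0r addr0.
case/nbhs_normP => d /= d0 hd.
have d20 : d / 2 != 0 by rewrite gt_eqF// divr_gt0.
have [|u eu uE] := hd (d / 2).
  rewrite /ball_/= sub0r normrN gtr0_norm ?divr_gt0//.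
  by rewrite ltr_pdivrMr// ltr_pMr// ltr1n.
have tu : tag u = p.
  have xu : cdom x (tag u) by exact/cdom_tag.
  rewrite -(cinvK base_max xu) -(cinvK base_max xp); congr (cinv x _).
  have := congr1 lsubmx uE; rewrite /l linearD linearZ /= row_mxKl scaler0 addr0.
  by rewrite (chart_split eu) (chart_split du0) !row_mxKl.
case: u tu eu uE => q w /= qp; subst q => eu uE.
(* the point reached has fibre coordinates [(d / 2) *: eta] *)
exists ((d / 2)^-1 *: w); rewrite ycoordZ//.
have -> : ycoord e (Tagged F w) = (d / 2) *: eta.
  rewrite /ycoord [e _]uE /l linearD linearZ /= row_mxKr.
  by rewrite -/(ycoord e u0) ycoord0// add0r.
by rewrite scalerA mulVf// scale1r.
Qed.

Lemma chart_fibre_line p (w w0 : F p) (t : R) : cdom x p ->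
  e (Tagged F (t *: w + w0)) =
  t *: row_mx 0 (ycoord e (Tagged F w)) + e (Tagged F w0).
Proof.
move=> xp; have d0 (w1 : F p) : cdom e (Tagged F w1) by exact/cdom_tag.
rewrite !chart_split//= ycoordP//.
by rewrite scale_row_mx add_row_mx scaler0 add0r.
Qed.

Lemma near_total y : cdom e y -> nbhs (y : TE) (cdom e).
Proof. exact/near_cdom/total_max. Qed.

Lemma near_base p : cdom x p -> nbhs (p : TM) (cdom x).
Proof. exact/near_cdom/base_max. Qed.

Lemma near_total_chart y : cdom e y ->
  \forall z \near e y, cdom e (cinv e z) /\ e (cinv e z) = z.
Proof.
by move=> ey; apply: filterS (near_chartP total_max ey (near_total ey)) => z [].
Qed.

Lemma near_base_chart p : cdom x p ->
  \forall z \near x p, cdom x (cinv x z) /\ x (cinv x z) = z.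
Proof.
by move=> ey; apply: filterS (near_chartP base_max ey (near_base ey)) => z [].
Qed.

(** In bundle coordinates the curve [t -> y + t w] is a straight line in the
    direction of the fibre. *)
Lemma vlift_chart y (w : F (tag y)) : cdom e y ->
  tcoord EE e y (vlift EE w) = row_mx 0 (ycoord e (Tagged F w)).
Proof.
move=> ey; have xy : cdom x (tag y) by exact/cdom_tag.
set v := row_mx _ _; set c := chart_at EE y.
have mc : max_atlas EE c by exact: max_chart_at.
have cy : cdom c y by exact: chart_at_dom.
pose l (t : R) : 'rV[R]_(m + k) := t *: v + e y.
have lE t : e (Tagged F (tagged y + t *: w)) = l t.
  rewrite addrC chart_fibre_line// /l /v.
  by case: y {ey c mc cy v l} w xy.
have fE : (fun t => c (Tagged F (tagged y + t *: w))) = (c \o cinv e) \o l.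
  apply/funext => t; rewrite /= -lE (cinvK total_max)//; exact/cdom_tag.
have [dl El] := diff_line v (e y) 0.
have l0 : l 0 = e y by rewrite /l scale0r add0r.
have dt : differentiable (c \o cinv e) (l 0).
  by rewrite l0; apply: smooth_differentiable; exact: (transition_max total_max mc).
have E1 : vlift EE w = jac e c y v.
  rewrite /vlift -/c fE (derive1E' (differentiable_comp dl dt)).
  apply: (etrans (congr1 (fun G : R -> 'rV[R]_(m + k) => G 1) (diff_comp dl dt))).
  apply: (etrans (congr1 ('d (c \o cinv e) (l 0)) El)).
  by rewrite /jac l0.
by rewrite E1 tcoordE -/c (jacK _ total_max mc).
Qed.

(** In bundle coordinates the projection is the projection on the first [m]
    components. *)
Lemma tag_chart y v : cdom e y ->
  tcoord MM x (tag y) (tmap EE MM tag y v) = lsubmx (tcoord EE e y v).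
Proof.
move=> ey; have xy : cdom x (tag y) by exact/cdom_tag.
pose L : {linear 'rV[R]_(m + k) -> 'rV[R]_m} := lsubmx.
have nE : {near e y, L =1 x \o tag \o cinv e}.
  apply: filterS (near_total_chart ey) => z [dz zE] /=.
  by rewrite -[in LHS]zE chart_split// row_mxKl.
have cL : continuous L by exact: linear_mx_continuous.
have dL := linear_differentiable (e y) cL.
have [dt Et] := near_eq_differentiable nE dL.
have nd : nbhs (y : TE) (cdom x \o tag).
  by apply: filterS (near_total ey) => u /cdom_tag.
apply: (etrans (tmap_chart v total_max base_max ey xy nd dt)).
apply: (etrans (congr1 (fun G : _ -> 'rV[R]_m => G _) Et)).
by rewrite diff_lin.
Qed.

Lemma vertical_chart y v : cdom e y ->
  vertical MM EE y v <-> lsubmx (tcoord EE e y v) = 0.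
Proof.
move=> ey; have xy : cdom x (tag y) by exact/cdom_tag.
rewrite -tag_chart// /vertical /=; split=> [->|h].
  by rewrite tcoordE /jac linear0.
by rewrite -(tcoordK (tmap EE MM tag y v) base_max xy) h tvecE /jac linear0.
Qed.

Lemma section_domain (phi : forall p, F p) p : cdom x p ->
  nbhs (p : TM) (cdom e \o section_map phi).
Proof. by move=> xp; apply: filterS (near_base xp) => q xq; exact/cdom_tag. Qed.

Lemma section_chart (phi : forall p, F p) p : cdom x p ->
  {near x p, (fun z => row_mx z ((ycoord e \o section_map phi \o cinv x) z)) =1
    e \o section_map phi \o cinv x}.
Proof.
move=> xp; apply: filterS (near_base_chart xp) => z [dz zE] /=.
by rewrite chart_split; [rewrite /= zE|exact/cdom_tag].
Qed.

(** In bundle coordinates a section is the graph [z -> (z, phi z)]. *)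
Lemma section_tmap (phi : forall p, F p) p z : cdom x p ->
  differentiable (ycoord e \o section_map phi \o cinv x) (x p) ->
  tcoord EE e (section_map phi p) (tmap MM EE (section_map phi) p z) =
  row_mx (tcoord MM x p z)
    ('d (ycoord e \o section_map phi \o cinv x) (x p) (tcoord MM x p z)).
Proof.
move=> xp df.
have [dr Er] := diff_row_mx (ex_diff (f := id)) df.
have [ds Es] := near_eq_differentiable (section_chart phi xp) dr.
have ep : cdom e (section_map phi p) by exact/cdom_tag.
apply: (etrans (tmap_chart z base_max total_max xp ep (section_domain phi xp) ds)).
apply: (etrans (congr1 (fun G : _ -> 'rV[R]_(m + k) => G _) Es)).
apply: (etrans (Er _)); apply: (congr1 (fun w => row_mx w _)).
by rewrite diff_val.
Qed.

Lemma smooth_section_diff (phi : forall p, F p) p : cdom x p ->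
  smooth_section_at MM EE phi p ->
  differentiable (ycoord e \o section_map phi \o cinv x) (x p).
Proof.
move=> xp sp; have ep : cdom e (section_map phi p) by exact/cdom_tag.
have [_ sm] := smooth_map_at_in_chart base_max total_max xp ep sp.
have cL : continuous (rsubmx : {linear 'rV[R]_(m + k) -> 'rV[R]_k}).
  exact: linear_mx_continuous.
exact: (diff_lin_comp 0 cL (smooth_differentiable sm)).1.
Qed.

Lemma smooth_section_of (phi : forall p, F p) p : cdom x p ->
  smooth_near (ycoord e \o section_map phi \o cinv x) (x p) ->
  smooth_section_at MM EE phi p.
Proof.
move=> xp sp; have ep : cdom e (section_map phi p) by exact/cdom_tag.
apply: (smooth_map_at_chart base_max total_max xp ep (section_domain phi xp)).
apply: near_eq_smooth (section_chart phi xp) _.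
by apply: smooth_row_mx => //; exact: smooth_id.
Qed.

End BundleChart.

(** * Global extensions and the connection in coordinates *)

Section SmoothFields.
Context {R : realType} {n : nat} {T : choiceType}.
Variable A : manifold R n T.

Lemma smooth_vf_near (X : T -> 'rV[R]_n) c p : smooth_vf A X ->
  max_atlas A c -> cdom c p -> smooth_near (vrep A c X) (c p).
Proof.
move=> sX mc cp; have Aa := chart_at_atlas A p; have ap := chart_at_dom A p.
have ma := atlas_max Aa.
apply: (vrep_smooth ma mc ap cp); apply: (smooth_on_near _ (sX _ Aa)).
  by case: ma => -[].
by exists p.
Qed.

Lemma near_smooth_vf (X : T -> 'rV[R]_n) :
  (forall p, exists2 c, max_atlas A c /\ cdom c p &
    smooth_near (vrep A c X) (c p)) -> smooth_vf A X.
Proof.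
move=> h d Ad; apply: near_smooth_on => z [p dp <-].
have [c [mc cp] sc] := h p; exact: (vrep_smooth mc (atlas_max Ad) cp dp).
Qed.

Lemma near_smooth_fun (f : T -> R) :
  (forall p, exists2 c, max_atlas A c /\ cdom c p &
    smooth_near (f \o cinv c) (c p)) -> smooth_fun A f.
Proof.
move=> h d p Ad dp _; have [c [mc cp] sc] := h p.
exact: (change_smooth mc (atlas_max Ad) cp dp).
Qed.

(** Multiplying by a bump function turns a local field into a global one. *)
Lemma smooth_vf_extend e p (w : 'rV[R]_n) : max_atlas A e -> cdom e p ->
  exists X, smooth_vf A X /\ tcoord A e p (X p) = w.
Proof.
move=> me ep; have [b [bp sb bz]] := bump_manifold me ep.
exists (fun u => b u *: tvec A e u w); split; last first.
  by rewrite bp scale1r tvecK.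
apply: near_smooth_vf => q; have [eq|neq] := pselect (cdom e q).
  exists e => //.
  have s := smooth_scale (sb e q me eq) (smooth_cst w (e q)).
  apply: near_eq_smooth s.
  apply: filterS (near_chartP me eq (near_cdom me eq)) => z [_ ez zE].
  rewrite /vrep /cst /= tcoordE.
  have -> : jac (chart_at A (cinv e z)) e (cinv e z) (b (cinv e z) *: tvec A e (cinv e z) w)
    = b (cinv e z) *: tcoord A e (cinv e z) (tvec A e (cinv e z) w).
    by rewrite /jac linearZ.
  by rewrite tvecK.
exists (chart_at A q); first by split; [exact: max_chart_at|exact: chart_at_dom].
have s0 : smooth_near (cst (0 : 'rV[R]_n)) (chart_at A q q) by exact: smooth_cst.
apply: near_eq_smooth s0.
have := near_chartP (max_chart_at A q) (chart_at_dom A q) (bz _ neq).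
apply: filterS => z [/= bz0 _ _].
by rewrite /vrep bz0 scale0r tcoordE /jac linear0.
Qed.

End SmoothFields.

Section ConnectionInChart.
Context {R : realType} {m k : nat} {M : choiceType}.
Variables (MM : manifold R m M) (F : M -> lmodType R).
Notation E := {p : M & F p}.
Variables (EE : manifold R (m + k) E).
Variables (N : E -> 'rV[R]_(m + k) -> 'rV[R]_(m + k)).
Variables (Psi : forall y : E, jet MM EE (tag y)).
Hypotheses (connN : connection_form MM EE N) (jetPsi : jet_field_of N Psi).
Variables (x : chart (R := R) m M) (e : chart (R := R) (m + k) E).
Hypothesis xe : bundle_chart MM EE x e.
Let me := total_max xe.
Let mx := base_max xe.

Lemma N_linear y : linear (N y).
Proof. by case: connN => -[h _] _ _; exact: h. Qed.

Lemma N_smooth X : smooth_vf EE X -> smooth_vf EE (fun y => N y (X y)).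
Proof. by case: connN => -[_ h] _ _; exact: h. Qed.

(** The one-forms dx^mu, cut off by a bump function, are global forms that
    vanish on vertical vectors. *)
Lemma N_base y v : cdom e y ->
  lsubmx (tcoord EE e y (N y v)) = lsubmx (tcoord EE e y v).
Proof.
move=> ey; have [b [by1 sb bz]] := bump_manifold me ey.
apply/rowP => mu.
pose alpha u w : R := b u * lsubmx (tcoord EE e u w) 0 mu.
have b0 u : ~ cdom e u -> b u = 0 by move=> /bz /nbhs_singleton.
have [_ _ hN] := connN.
have := hN alpha _ _ y v; rewrite /alpha by1 !mul1r; apply.
  split=> [u a w w'|X sX].
    rewrite /alpha tcoordE.
    have -> : jac (chart_at EE u) e u (a *: w + w') =
      a *: jac (chart_at EE u) e u w + jac (chart_at EE u) e u w' by exact: jac_linear.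
    rewrite !linearP /= !mxE -[X in _ = X + _]/(a * _).
    by rewrite mulrDr mulrCA.
  apply: near_smooth_fun => q; have [eq|neq] := pselect (cdom e q).
    exists e => //.
    pose L : {linear 'rV[R]_(m + k) -> 'rV[R]_m} := lsubmx.
    have s1 := smooth_coord 0 mu (smooth_mx_lin L (smooth_vf_near sX me eq)).
    exact: (smooth_scale (sb e q me eq) s1).
  exists (chart_at EE q); first by split; [exact: max_chart_at|exact: chart_at_dom].
  have s0 : smooth_near (cst (0 : R)) (chart_at EE q q) by exact: smooth_cst.
  apply: near_eq_smooth s0.
  have := near_chartP (max_chart_at EE q) (chart_at_dom EE q) (bz _ neq).
  by apply: filterS => z [/= bz0 _ _]; rewrite /= /alpha bz0 mul0r.
move=> u w vw; rewrite /alpha; have [eu|/b0->] := pselect (cdom e u); last by rewrite mul0r.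
by rewrite ((vertical_chart xe w eu).1 vw) mxE mulr0.
Qed.

(** Rows are indexed by [mu], so that the connection sends a horizontal component
    [a] to the vertical component [a *m conn_coeff y]. *)
Definition conn_coeff (y : E) : 'M[R]_(m, k) := \matrix_(mu, i) Gamma EE N e i mu y.

(** A tangent vector is a combination of the [d/dx^mu] up to a vertical vector,
    which the connection kills. *)
Lemma N_chart y v : cdom e y ->
  tcoord EE e y (N y v) =
  row_mx (lsubmx (tcoord EE e y v)) (lsubmx (tcoord EE e y v) *m conn_coeff y).
Proof.
move=> ey; rewrite -[LHS]hsubmxK N_base//; congr row_mx.
set w := tcoord EE e y v.
have Nv : N y v = \sum_mu lsubmx w 0 mu *: N y (tvec EE e y (delta_mx 0 (lshift k mu))).
  pose Ny : {linear 'rV[R]_(m + k) -> 'rV[R]_(m + k)} :=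
    HB.pack (N y) (GRing.isLinear.Build _ _ _ _ _ (N_linear y)).
  pose tv : {linear 'rV[R]_(m + k) -> 'rV[R]_(m + k)} :=
    HB.pack (tvec EE e y) (GRing.isLinear.Build _ _ _ _ _ (tvec_linear EE e y)).
  have vE : v = tv (row_mx (lsubmx w) 0) + tv (row_mx 0 (rsubmx w)).
    by rewrite -linearD add_row_mx addr0 add0r hsubmxK /= tcoordK.
  have wE : row_mx (lsubmx w) 0 = \sum_mu lsubmx w 0 mu *: delta_mx 0 (lshift k mu).
    rewrite [X in row_mx X _](row_sum_delta (lsubmx w)).
    have rE (u : 'rV[R]_m) : row_mx u (0 : 'rV[R]_k) = mulmxr (row_mx 1%:M 0) u.
      by rewrite /= mul_mx_row mulmx1 mulmx0.
    rewrite rE linear_sum; apply: eq_bigr => mu _.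
    rewrite linearZ /= mul_mx_row mulmx1 mulmx0.
    congr (_ *: _); apply/rowP => j; rewrite !mxE eqxx /=.
    case: splitP => j' jE.
      by rewrite mxE eqxx /=; congr (_%:R); rewrite -!val_eqE /= jE.
    by rewrite mxE eqE /= jE gtn_eqF// ltn_addr.
  have -> : N y v = Ny (tv (row_mx (lsubmx w) 0)).
    have -> : N y v = Ny v by [].
    rewrite vE linearD [X in _ + X](_ : _ = 0) ?addr0//.
    have [_ hv _] := connN; apply: hv.
    by apply/(vertical_chart xe _ ey); rewrite /= tvecK// row_mxKl.
  by rewrite wE !linear_sum; apply: eq_bigr => mu _; rewrite !linearZ.
pose tc : {linear 'rV[R]_(m + k) -> 'rV[R]_(m + k)} :=
    HB.pack (tcoord EE e y) (GRing.isLinear.Build _ _ _ _ _ (tcoord_linear EE e y)).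
have -> : tcoord EE e y (N y v) = tc (N y v) by [].
rewrite Nv !linear_sum mulmx_sum_row; apply: eq_bigr => mu _.
rewrite !linearZ; congr (_ *: _); apply/rowP => i.
by rewrite !mxE /Gamma.
Qed.

(** The connection form is a projection, so the horizontal vectors are its fixed
    points: in coordinates, the graph of [a -> a g]. *)
Lemma horizontal_chart y v : cdom e y -> horizontal N y v <->
  rsubmx (tcoord EE e y v) = lsubmx (tcoord EE e y v) *m conn_coeff y.
Proof.
move=> ey; split=> [[u _ <-]|h].
  by rewrite N_chart// row_mxKr row_mxKl.
exists v => //; rewrite -[LHS](tcoordK _ me ey) N_chart// -h hsubmxK.
exact: tcoordK.
Qed.

Lemma jrepP p (j : jet MM EE p) :
  [/\ smooth_section_at MM EE (jrep j) p, jclass j = jet1 MM EE p (jrep j) &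
      jclass j (jrep j)].
Proof.
have [s jE] := projT2 (cid (jclassP j)).
by split=> //; rewrite jE.
Qed.

(** The velocity of a representative in direction [z] is horizontal and projects
    on [z]; there is only one such vector. *)
Lemma jet_derivative p (w : F p) (phi : forall q, F q) z :
  cdom x p -> jclass (Psi (Tagged F w)) phi ->
  phi p = w /\ 'd (ycoord e \o section_map phi \o cinv x) (x p) z =
    z *m conn_coeff (Tagged F w).
Proof.
move=> xp jphi; have [[jv _] jr] := jetPsi.
have pw : phi p = w by exact: (jv _ _ jphi).
split=> //; subst w.
have ep : cdom e (section_map phi p) by exact/(cdom_tag xe).
have sp : smooth_section_at MM EE phi p.
  by have [_ jE _] := jrepP (Psi (Tagged F (phi p))); move: jphi; rewrite jE => -[].
have H := section_tmap xe (tvec MM x p z) xp (smooth_section_diff xe xp sp).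
have hor : horizontal N (section_map phi p)
    (tmap MM EE (section_map phi) p (tvec MM x p z)).
  by rewrite (jr _ _ jphi) /=; exists (tvec MM x p z).
have {hor} := (horizontal_chart _ ep).1 hor.
rewrite H row_mxKr row_mxKl tvecK//; exact: id.
Qed.

(** The coefficients of the connection are the coordinates [y^i_mu] of its jet
    field. *)
Lemma conn_coeff_smooth y : cdom e y -> smooth_near (conn_coeff \o cinv e) (e y).
Proof.
move=> ey; have [[_ sPsi] _] := jetPsi.
have sj : smooth_near (fun z => jet_coord x e (Psi (cinv e z))) (e y).
  apply: (smooth_on_near _ (sPsi x e xe)); first by case: me => -[].
  by exists y.
pose S : {linear ('rV[R]_(m + k) * 'M[R]_(m, k))%type -> 'M[R]_(m, k)} := snd.
have cS : continuous S by move=> z; exact: cvg_snd.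
have := smooth_lin_comp cS sj; apply: near_eq_smooth.
apply: filterS (near_total_chart xe ey) => z [dz _].
apply/matrixP => mu i; rewrite /= mxE.
have xz : cdom x (tag (cinv e z)) by exact/(cdom_tag xe).
case: (cinv e z) xz => p w /= xp.
have [_ _ jc] := jrepP (Psi (Tagged F w)).
have [_ E] := jet_derivative (delta_mx 0 mu) xp jc.
rewrite -[conn_coeff _ mu i]/(conn_coeff (Tagged F w) mu i).
apply: (etrans (congr1 (fun v : 'rV[R]_k => v 0 i) E)).
by rewrite -rowE mxE.
Qed.

End ConnectionInChart.

(** * Homogeneity along the fibres *)

(** The quotient by the parameter is constant: with an exponential
    parametrization its derivative vanishes on the whole line. *)
Lemma euler_ode (R : realType) (h : R -> R) :
  (forall s : R, 0 < s -> is_derive s 1 h (s^-1 * h s)) ->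
  forall t : R, 0 < t -> h t = t * h 1.
Proof.
move=> dh t t0; pose f (s : R) : R := expR (- s) * h (expR s).
have df (s : R) : is_derive s 1 f 0.
  have dhs := dh _ (expR_gt0 s).
  have d1 := @is_derive1_comp R h expR s _ _ dhs (is_derive_expR s).
  have d2 := @is_derive1_comp R expR -%R s _ _ (is_derive_expR _) (is_deriveNid _ _).
  apply: (is_derive_eq (is_deriveM d2 d1)).
  rewrite -[_ *: _]/(_ * _) -[X in _ + X]/(_ * _).
  have e1 := mulVf (lt0r_neq0 (expR_gt0 s)).
  rewrite /= expRN; set b := h _.
  have -> : (expR s)^-1 * b * expR s = b by rewrite mulrAC e1 mul1r.
  by rewrite mulrN1 mulrN (mulrC b) addrN.
have E0 : f (ln t) = f 0 by exact: is_derive_0_is_cst.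
have Et : f (ln t) = t^-1 * h t.
  have lt : expR (ln t) = t by rewrite lnK ?posrE.
  by rewrite /f expRN lt.
have E1 : f 0 = h 1 by rewrite /f oppr0 expR0 mul1r.
rewrite -E1 -E0 Et; exact: esym (mulVKf (lt0r_neq0 t0) _).
Qed.

Section Homogeneity.
Context {R : realType} {m k : nat} {M : choiceType}.
Variables (MM : manifold R m M) (F : M -> lmodType R).
Notation E := {p : M & F p}.
Variables (EE : manifold R (m + k) E).
Variables (N : E -> 'rV[R]_(m + k) -> 'rV[R]_(m + k)).
Variables (Psi : forall y : E, jet MM EE (tag y)).
Hypotheses (connN : connection_form MM EE N) (jetPsi : jet_field_of N Psi).
Variables (x : chart (R := R) m M) (e : chart (R := R) (m + k) E).
Hypothesis xe : bundle_chart MM EE x e.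
Let me := total_max xe.
Notation gam := (conn_coeff EE N e).

Definition homogeneous := forall p (w : F p) (t : R), cdom x p -> 0 < t ->
  gam (Tagged F (t *: w)) = t *: gam (Tagged F w).

Definition euler := forall u, cdom e u ->
  'd (gam \o cinv e) (e u) (row_mx 0 (ycoord e u)) = gam u.

Definition fibre_linear := forall p (a : R) (w w' : F p), cdom x p ->
  gam (Tagged F (a *: w + w')) = a *: gam (Tagged F w) + gam (Tagged F w').

(** A line in a fibre is a straight line in bundle coordinates, to which the
    chain rule applies. *)
Lemma fibre_line_diff p (w w0 : F p) (t : R) : cdom x p ->
  differentiable (fun s : R => gam (Tagged F (s *: w + w0))) t /\
  'd (fun s : R => gam (Tagged F (s *: w + w0))) t 1 =
    'd (gam \o cinv e) (e (Tagged F (t *: w + w0))) (row_mx 0 (ycoord e (Tagged F w))).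
Proof.
move=> xp; have d0 (w1 : F p) : cdom e (Tagged F w1) by exact/(cdom_tag xe).
pose v := row_mx 0 (ycoord e (Tagged F w)) : 'rV[R]_(m + k).
have [dl El] := diff_line v (e (Tagged F w0)) t.
have tE s : s *: v + e (Tagged F w0) = e (Tagged F (s *: w + w0)).
  by rewrite (chart_fibre_line xe).
have dg : differentiable (gam \o cinv e) (t *: v + e (Tagged F w0)).
  by rewrite tE; exact/smooth_differentiable/(conn_coeff_smooth connN jetPsi xe).
have -> : (fun s : R => gam (Tagged F (s *: w + w0))) =
    (gam \o cinv e) \o (fun s => s *: v + e (Tagged F w0)).
  by apply/funext => s; rewrite /= tE (cinvK me).
split; first exact: differentiable_comp.
apply: (etrans (congr1 (fun G : R -> 'M[R]_(m, k) => G 1) (diff_comp dl dg))).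
apply: (etrans (congr1 ('d (gam \o cinv e) (t *: v + e (Tagged F w0))) El)).
by rewrite tE.
Qed.

(** Along [s -> w + s w] the coefficients are [(1 + s) g(w)] for small [s]. *)
Lemma homogeneous_euler : homogeneous -> euler.
Proof.
move=> H [p w] eu; have xp : cdom x p by exact: (cdom_tag xe _).1 eu.
have [dg Eg] := fibre_line_diff w w 0 xp.
rewrite scale0r add0r in Eg; apply: (etrans (esym Eg)).
have [dl El] := diff_line (gam (Tagged F w)) (gam (Tagged F w)) 0.
have nE : {near (0 : R), (fun s : R => s *: gam (Tagged F w) + gam (Tagged F w)) =1
   (fun s : R => gam (Tagged F (s *: w + w)))}.
  near=> s; rewrite -[X in _ *: w + X]scale1r -scalerDl H//.
    by rewrite scalerDl scale1r.
  rewrite -ltrBlDr sub0r; near: s; apply: lt_nbhsr; by rewrite ltrN10.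
have [_ E2] := near_eq_differentiable nE dl.
exact: (etrans (congr1 (fun G : R -> 'M[R]_(m, k) => G 1) E2) El).
Unshelve. all: by end_near. Qed.

(** Restricted to a ray, Euler's equation is the ordinary differential equation
    [s h'(s) = h(s)]. *)
Lemma euler_homogeneous : euler -> homogeneous.
Proof.
move=> H p w t xp t0; apply/matrixP => mu i; rewrite [RHS]mxE.
pose h (s : R) : R := gam (Tagged F (s *: w + 0)) mu i.
have hE s : h s = gam (Tagged F (s *: w)) mu i by rewrite /h addr0.
have dh (s : R) : 0 < s -> is_derive s 1 h (s^-1 * h s).
  move=> s0.
  have [dg Eg] := fibre_line_diff w 0 s xp.
  have [dL EL] := diff_entry mu i (1 : R) dg.
  apply: DeriveDef; first exact: diff_derivable.
  apply: (etrans (deriveE _ dL)); apply: (etrans EL).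
  have sE : ycoord e (Tagged F w) = s^-1 *: ycoord e (Tagged F (s *: w + 0)).
    by rewrite addr0 (ycoordZ xe)// scalerA mulVf ?scale1r// gt_eqF.
  have ev : row_mx 0 (ycoord e (Tagged F w)) =
     s^-1 *: row_mx 0 (ycoord e (Tagged F (s *: w + 0))) :> 'rV[R]_(m + k).
    by rewrite [in LHS]sE scale_row_mx scaler0.
  have du : cdom e (Tagged F (s *: w + 0)) by exact/(cdom_tag xe).
  have Hs : 'd (gam \o cinv e) (e (Tagged F (s *: w + 0)))
      (row_mx 0 (ycoord e (Tagged F w))) = s^-1 *: gam (Tagged F (s *: w + 0)).
    rewrite ev; apply: (etrans (linearZ _ _)).
    exact: (congr1 (fun A => s^-1 *: A) (H _ du)).
  apply: (etrans (congr1 (@entry R m k mu i) (etrans Eg Hs))).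
  by rewrite /entry [LHS]mxE.
have h1 : h 1 = gam (Tagged F w) mu i by rewrite /h addr0 scale1r.
apply: (etrans (esym (hE t))); apply: etrans (congr1 (fun r => t * r) h1).
exact: euler_ode.
Qed.

(** Differentiability at the origin forces the derivative to be the slope on the
    right. *)
Lemma one_sided_slope (f : R -> R) (c : R) : differentiable f 0 -> f 0 = 0 ->
  (forall t, 0 < t -> f t = t * c) -> 'd f 0 1 = c.
Proof.
move=> df f0 fc; apply/eqP; rewrite eq_sym -subr_eq0 -normr_le0.
apply/ler_addgt0Pl => r r0; rewrite addr0.
have [d d0 hd] := diff_remainder df r0.
have d2 : 0 < d / 2 by rewrite divr_gt0.
have := hd (d / 2); rewrite gtr0_norm// ltr_pdivrMr// ltr_pMr// ltr1n => /(_ isT).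
rewrite addr0 f0 subr0 fc//.
have -> : 'd f 0 (d / 2) = d / 2 * 'd f 0 1.
  by rewrite -[X in 'd f 0 X]mulr1; exact: linearZ.
by rewrite -mulrBr normrM (gtr0_norm d2) mulrC ler_pM2r.
Qed.

(** Homogeneity with factor two at the origin of the fibre. *)
Lemma homogeneous0 p : homogeneous -> cdom x p -> gam (Tagged F (0 : F p)) = 0.
Proof.
move=> H xp; have := H p 0 2 xp (ltr0Sn _ _).
rewrite scaler0 scaler_nat mulr2n => E0.
by apply: (addrI (gam (Tagged F (0 : F p)))); rewrite addr0.
Qed.

(** Along each ray the function is equal to its slope at the origin, that is to
    the value of the differential on the direction of the ray. *)
Lemma homogeneous_diff0 p (w : F p) : homogeneous -> cdom x p ->
  gam (Tagged F w) =
  'd (gam \o cinv e) (row_mx (x p) 0) (row_mx 0 (ycoord e (Tagged F w))).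
Proof.
move=> H xp; have [dg Eg] := fibre_line_diff w 0 0 xp.
have e0 : e (Tagged F (0 *: w + 0)) = row_mx (x p) 0.
  rewrite scale0r addr0 (chart_split xe); last exact/(cdom_tag xe).
  by rewrite (ycoord0 xe).
rewrite e0 in Eg; apply: etrans Eg.
apply/matrixP => mu i.
have [dL EL] := diff_entry mu i (1 : R) dg.
apply: esym; apply: (etrans (esym EL)).
apply: one_sided_slope => //.
  rewrite /= scale0r addr0.
  by rewrite homogeneous0// mxE.
by move=> t t0; rewrite /= addr0 H// [LHS]mxE.
Qed.

Lemma homogeneous_linear : homogeneous -> fibre_linear.
Proof.
move=> H p a w w' xp; rewrite 3?(homogeneous_diff0 _ H xp) (ycoordP xe)//.
have rE (u v : 'rV[R]_k) : row_mx 0 (a *: u + v) =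
    a *: row_mx 0 u + row_mx 0 v :> 'rV[R]_(m + k).
  by rewrite scale_row_mx add_row_mx scaler0 addr0.
by rewrite rE; exact: linearP.
Qed.

Lemma linear_homogeneous : fibre_linear -> homogeneous.
Proof.
move=> H p w t xp _.
have H0 : gam (Tagged F (0 : F p)) = 0.
  have := H p 0 0 0 xp; rewrite !scale0r add0r; have := H p 1 0 0 xp.
  rewrite !scale1r addr0 => h _.
  by apply: (addrI (gam (Tagged F (0 : F p)))); rewrite addr0 -h.
have tw : Tagged F (t *: w) = Tagged F (t *: w + 0) by rewrite addr0.
apply: (etrans (congr1 gam tw)); apply: (etrans (H p t w 0 xp)).
exact: (etrans (congr1 (fun A => t *: gam (Tagged F w) + A) H0) (addr0 _)).
Qed.

End Homogeneity.

(** * The Lie derivative, the dilations and the covariant derivative in coordinates *)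

Section Derivation.
Context {R : realType} {m k : nat} {M : choiceType}.
Variables (MM : manifold R m M) (F : M -> lmodType R).
Notation E := {p : M & F p}.
Variables (EE : manifold R (m + k) E).
Variables (N : E -> 'rV[R]_(m + k) -> 'rV[R]_(m + k)).
Variables (Psi : forall y : E, jet MM EE (tag y)).
Hypotheses (connN : connection_form MM EE N) (jetPsi : jet_field_of N Psi).
Variables (x : chart (R := R) m M) (e : chart (R := R) (m + k) E).
Hypothesis xe : bundle_chart MM EE x e.
Let me := total_max xe.
Notation gam := (conn_coeff EE N e).

Lemma liouville_chart u : cdom e u ->
  [/\ vrep EE e (liouville EE) (e u) = row_mx 0 (ycoord e u),
      differentiable (vrep EE e (liouville EE)) (e u) &
      forall v, 'd (vrep EE e (liouville EE)) (e u) v = row_mx 0 (rsubmx v)].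
Proof.
move=> eu; pose L : {linear 'rV[R]_(m + k) -> 'rV[R]_(m + k)} :=
  mulmxr (row_mx 0 1%:M) \o rsubmx.
have LE v : L v = row_mx 0 (rsubmx v) by rewrite /L /= mul_mx_row mulmx0 mulmx1.
have vE y : cdom e y -> tcoord EE e y (liouville EE y) = row_mx 0 (ycoord e y).
  by move=> ey; rewrite /liouville (vlift_chart xe)//; case: y ey.
have nE : {near e u, L =1 vrep EE e (liouville EE)}.
  apply: filterS (near_total_chart xe eu) => z [dz zE].
  by rewrite /vrep vE// LE /ycoord zE.
have cL : continuous L by exact: linear_mx_continuous.
have [dv Ev] := near_eq_differentiable nE (linear_differentiable (e u) cL).
split; [|exact: dv|].
  apply: etrans (vE u eu).
  exact: (congr1 (fun y => tcoord EE e y (liouville EE y)) (cinvK me eu)).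
move=> v; apply: (etrans (congr1 (fun G : _ -> 'rV[R]_(m + k) => G v) Ev)).
by rewrite diff_lin// LE.
Qed.

(** The product rule applied to the coordinate expression [(xi, xi g)] of the
    image of a field under the connection form. *)
Lemma N_vrep_chart u X : cdom e u -> smooth_vf EE X ->
  differentiable (vrep EE e (fun y => N y (X y))) (e u) /\
  forall v, 'd (vrep EE e (fun y => N y (X y))) (e u) v =
    row_mx (lsubmx ('d (vrep EE e X) (e u) v))
      (lsubmx ('d (vrep EE e X) (e u) v) *m gam u +
       lsubmx (tcoord EE e u (X u)) *m 'd (gam \o cinv e) (e u) v).
Proof.
move=> eu sX; have dX := smooth_differentiable (smooth_vf_near sX me eu).
have dg := smooth_differentiable (conn_coeff_smooth connN jetPsi xe eu).
pose L : {linear 'rV[R]_(m + k) -> 'rV[R]_m} := lsubmx.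
have cL : continuous L by exact: linear_mx_continuous.
have [dl _] := diff_lin_comp 0 cL dX.
have El v := (diff_lin_comp v cL dX).2.
have [dp Ep] := diff_mulmx dl dg.
have [dr Er] := diff_row_mx dl dp.
have nE : {near e u, (fun z => row_mx ((L \o vrep EE e X) z)
    ((L \o vrep EE e X) z *m (gam \o cinv e) z)) =1 vrep EE e (fun y => N y (X y))}.
  apply: filterS (near_total_chart xe eu) => z [dz zE].
  by rewrite /vrep (N_chart connN xe).
have [dv Ev] := near_eq_differentiable nE dr.
split; [exact: dv|move=> v].
apply: (etrans (congr1 (fun G : _ -> 'rV[R]_(m + k) => G v) Ev)).
apply: (etrans (Er v)).
apply: (etrans (congr1 (fun A => row_mx ('d (L \o vrep EE e X) (e u) v) A) (Ep v))).
apply: (etrans (congr1 (fun a => row_mx a (a *m _ + _)) (El v))).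
have g1 : (gam \o cinv e) (e u) = gam u by exact: (congr1 gam (cinvK me eu)).
have x1 : (L \o vrep EE e X) (e u) = lsubmx (tcoord EE e u (X u)).
  by rewrite /= /vrep (cinvK me).
move: ('d _ _ _) ('d _ _ _) => a g'.
exact: (congr2 (fun g xi => row_mx (L a) (L a *m g + xi *m g')) g1 x1).
Qed.

(** The derivatives of [X] cancel, as they must since the Lie derivative of a
    tensor is a tensor; what is left is the derivative of the coefficients along
    the Liouville field and the term [- xi g] that comes from the derivative of
    the Liouville field itself. *)
Lemma lie_tensor_chart u X : cdom e u -> smooth_vf EE X ->
  tcoord EE e u (lie_tensor EE (liouville EE) N X u) =
  row_mx 0 (lsubmx (tcoord EE e u (X u)) *m
    ('d (gam \o cinv e) (e u) (row_mx 0 (ycoord e u)) - gam u)).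
Proof.
move=> eu sX; have dX := smooth_differentiable (smooth_vf_near sX me eu).
have [D0 dD ED] := liouville_chart eu.
have [dNX ENX] := N_vrep_chart eu sX.
have vX : vrep EE e X (e u) = tcoord EE e u (X u) by rewrite /vrep (cinvK me).
have vNX : vrep EE e (fun y => N y (X y)) (e u) = tcoord EE e u (N u (X u)).
  by rewrite /vrep (cinvK me).
set zeta := row_mx 0 (ycoord e u).
have B1 := bracket_chart me eu dD dX.
have B2 := bracket_chart me eu dD dNX.
have {}B1 : tcoord EE e u (bracket EE (liouville EE) X u) =
    'd (vrep EE e X) (e u) zeta - row_mx 0 (rsubmx (tcoord EE e u (X u))).
  apply: (etrans B1); apply: congr2.
    exact: (congr1 ('d (vrep EE e X) (e u)) D0).
  apply: (congr1 -%R); apply: (etrans (ED _)).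
  by apply: (congr1 (fun a => row_mx 0 (rsubmx a))); exact: vX.
have {}B2 : tcoord EE e u (bracket EE (liouville EE) (fun y => N y (X y)) u) =
    'd (vrep EE e (fun y => N y (X y))) (e u) zeta -
    row_mx 0 (lsubmx (tcoord EE e u (X u)) *m gam u).
  apply: (etrans B2); apply: congr2.
    exact: (congr1 ('d (vrep EE e (fun y => N y (X y))) (e u)) D0).
  apply: (congr1 -%R); apply: (etrans (ED _)); apply: (congr1 (row_mx 0)).
  apply: (etrans (congr1 rsubmx vNX)).
  by rewrite (N_chart connN xe)// row_mxKr.
have B3 := N_chart connN xe (bracket EE (liouville EE) X u) eu.
have lB1 : lsubmx (tcoord EE e u (bracket EE (liouville EE) X u)) =
    lsubmx ('d (vrep EE e X) (e u) zeta).
  apply: (etrans (congr1 lsubmx B1)).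
  move: ('d _ _ _) => a; by rewrite linearB /= row_mxKl subr0.
have S : tcoord EE e u (lie_tensor EE (liouville EE) N X u) =
  tcoord EE e u (bracket EE (liouville EE) (fun y => N y (X y)) u) -
  tcoord EE e u (N u (bracket EE (liouville EE) X u)) by exact: jacB.
apply: (etrans S); rewrite B2 B3 lB1.
apply: (etrans (congr1 (fun a => a - _ - _) (ENX zeta))).
set a := lsubmx ('d _ _ _); set g' := 'd _ _ _.
move: a g' => a g'; set xi := lsubmx _; move: xi (gam u) => xi g.
rewrite mulmxBr !opp_row_mx !add_row_mx oppr0 addr0 subrr.
by congr row_mx; rewrite addrAC (addrC (a *m g)) addrK.
Qed.

(** The Lie derivative of the identity vanishes: the bracket is additive. *)
Lemma lie_tensor_complement X u : smooth_vf EE X ->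
  lie_tensor EE (liouville EE) (fun y v => v - N y v) X u =
  - lie_tensor EE (liouville EE) N X u.
Proof.
move=> sX; set c := chart_at EE u.
have mc : max_atlas EE c by exact: max_chart_at.
have cu : cdom c u by exact: chart_at_dom.
have dX := smooth_differentiable (smooth_vf_near sX mc cu).
have dNX := smooth_differentiable (smooth_vf_near (N_smooth connN sX) mc cu).
have vE : vrep EE c (fun y => X y - N y (X y)) =
   vrep EE c X - vrep EE c (fun y => N y (X y)).
  by apply/funext => z; rewrite /vrep; exact: jacB.
have B : bracket EE (liouville EE) (fun y => X y - N y (X y)) u =
   bracket EE (liouville EE) X u - bracket EE (liouville EE) (fun y => N y (X y)) u.
  rewrite /bracket -/c vE.
  apply: (etrans (congr1 (fun G : _ -> 'rV[R]_(m + k) => G (liouville EE u) - _)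
    (diffB dX dNX))).
  apply: (etrans (congr1 (fun a => _ - a) (linearB _ _ _))).
  have alg (a b a' b' : 'rV[R]_(m + k)) : (a - b) - (a' - b') = (a - a') - (b - b').
    by rewrite !opprD !opprK addrACA.
  exact: alg.
have alg (a b n : 'rV[R]_(m + k)) : (a - b) - (a - n) = - (b - n).
  by rewrite addrC !opprB addrA subrK.
rewrite /lie_tensor B; exact: alg.
Qed.

Lemma euler_lie : euler EE N e -> forall X, smooth_vf EE X ->
  forall u, cdom e u -> lie_tensor EE (liouville EE) N X u = 0.
Proof.
move=> H X sX u eu; rewrite -[LHS](tcoordK _ me eu) lie_tensor_chart//.
have -> : 'd (gam \o cinv e) (e u) (row_mx 0 (ycoord e u)) - gam u = 0.
  by apply/eqP; rewrite subr_eq0; apply/eqP; exact: H.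
by rewrite mulmx0 row_mx0 tvecE /jac linear0.
Qed.

(** Tested on fields with prescribed value [d/dx^mu] at one point. *)
Lemma lie_euler : (forall X, smooth_vf EE X ->
  forall u, lie_tensor EE (liouville EE) N X u = 0) -> euler EE N e.
Proof.
move=> H u eu; apply/eqP; rewrite -subr_eq0; apply/eqP.
set A := _ - _; apply/row_matrixP => mu; rewrite row0.
have [X [sX XE]] := smooth_vf_extend (row_mx (delta_mx 0 mu) 0) me eu.
have := lie_tensor_chart eu sX; rewrite H// XE row_mxKl -rowE -/A.
rewrite tcoordE /jac linear0 => /(congr1 rsubmx).
by rewrite row_mxKr linear0.
Qed.

Lemma dilation_chart (t : R) y v : cdom e y ->
  tcoord EE e (dilation t y) (tmap EE EE (dilation t) y v) =
  row_mx (lsubmx (tcoord EE e y v)) (t *: rsubmx (tcoord EE e y v)).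
Proof.
move=> ey; have ety : cdom e (dilation t y).
  by apply/(cdom_tag xe); exact: (cdom_tag xe y).1.
pose L : {linear 'rV[R]_(m + k) -> 'rV[R]_(m + k)} :=
  mulmxr (block_mx 1%:M 0 0 t%:M).
have LE v' : L v' = row_mx (lsubmx v') (t *: rsubmx v').
  rewrite /L /= -{1}(hsubmxK v') mul_row_block !mulmx0 mulmx1 addr0 add0r.
  by rewrite mul_mx_scalar.
have nd : nbhs (y : atlas_space (atlas EE)) (cdom e \o dilation t).
  apply: filterS (near_total xe ey) => u /(cdom_tag xe) xu.
  exact/(cdom_tag xe).
have nE : {near e y, L =1 e \o dilation t \o cinv e}.
  apply: filterS (near_total_chart xe ey) => z [dz zE].
  have xz : cdom x (tag (cinv e z)) by exact: (cdom_tag xe _).1.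
  rewrite LE -{1 2}zE (chart_split xe dz) row_mxKl row_mxKr.
  rewrite [RHS](chart_split xe); last exact: (cdom_tag xe _).2.
  rewrite /= /dilation (ycoordZ xe)//.
  by case: (cinv e z).
have cL : continuous L by exact: linear_mx_continuous.
have [dv Ev] := near_eq_differentiable nE (linear_differentiable (e y) cL).
apply: (etrans (tmap_chart v me me ey ety nd dv)).
apply: (etrans (congr1 (fun G : _ -> 'rV[R]_(m + k) => G _) Ev)).
by rewrite diff_lin// LE.
Qed.

(** The dilation is [(a, b) -> (a, t b)] in components and maps the graph of
    [a -> a g(y)] onto the graph of [a -> t a g(y)]. *)
Lemma dilation_horizontal (t : R) y : 0 < t -> cdom e y ->
  tmap EE EE (dilation t) y @` horizontal N y = horizontal N (dilation t y) <->
  gam (dilation t y) = t *: gam y.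
Proof.
move=> t0 ey; have ety : cdom e (dilation t y).
  by apply/(cdom_tag xe); exact: (cdom_tag xe y).1.
split=> [H|H].
  apply/row_matrixP => mu.
  pose v := tvec EE e y (row_mx (delta_mx 0 mu) (delta_mx 0 mu *m gam y)).
  have hv : horizontal N y v.
    by apply/(horizontal_chart connN xe _ ey); rewrite tvecK// row_mxKl row_mxKr.
  have : horizontal N (dilation t y) (tmap EE EE (dilation t) y v).
    by rewrite -H; exists v.
  move/(horizontal_chart connN xe _ ety); rewrite dilation_chart// tvecK//.
  by rewrite !row_mxKl !row_mxKr !rowE -scalemxAr => ->.
have hor v : horizontal N y v <-> horizontal N (dilation t y) (tmap EE EE (dilation t) y v).
  split=> [/(horizontal_chart connN xe _ ey)|/(horizontal_chart connN xe _ ety)] h.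
    apply/(horizontal_chart connN xe _ ety).
    by rewrite (dilation_chart t v ey) row_mxKl row_mxKr h H -scalemxAr.
  apply/(horizontal_chart connN xe _ ey); move: h.
  rewrite (dilation_chart t v ey) row_mxKl row_mxKr H -scalemxAr.
  by apply: scalerI; rewrite gt_eqF.
apply/seteqP; split=> [_ [v /hor hv <-]//|w hw].
pose w' := tcoord EE e (dilation t y) w.
pose v := tvec EE e y (row_mx (lsubmx w') (t^-1 *: rsubmx w')).
have vw : tmap EE EE (dilation t) y v = w.
  rewrite -[LHS](tcoordK _ me ety) dilation_chart// tvecK// row_mxKl row_mxKr.
  by rewrite scalerA divff ?gt_eqF// scale1r hsubmxK tcoordK.
by exists v => //; apply/hor; rewrite vw.
Qed.

(** The vector to which [sharp] is applied has components [(0, b)], and the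
    identification of the fibre with its tangent space is the one given by the
    fibre coordinates. *)
Lemma covder_chart (phi : forall q, F q) p z : cdom x p ->
  differentiable (ycoord e \o section_map phi \o cinv x) (x p) ->
  ycoord e (Tagged F (covder MM EE N phi p z)) =
  'd (ycoord e \o section_map phi \o cinv x) (x p) (tcoord MM x p z) -
  tcoord MM x p z *m gam (section_map phi p).
Proof.
move=> xp df; have ep : cdom e (section_map phi p) by exact/(cdom_tag xe).
set y := section_map phi p; set v := tmap MM EE (section_map phi) p z.
have vE : tcoord EE e y v = row_mx (tcoord MM x p z)
    ('d (ycoord e \o section_map phi \o cinv x) (x p) (tcoord MM x p z)).
  exact: section_tmap.
have dE : tcoord EE e y (v - N y v) = row_mx 0
   ('d (ycoord e \o section_map phi \o cinv x) (x p) (tcoord MM x p z) -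
    tcoord MM x p z *m gam y).
  have tB : tcoord EE e y (v - N y v) = tcoord EE e y v - tcoord EE e y (N y v).
    exact: jacB.
  rewrite tB (N_chart connN xe v ep) vE.
  by rewrite row_mxKl opp_row_mx add_row_mx subrr.
have [w wE] := ycoord_surj xe ('d (ycoord e \o section_map phi \o cinv x) (x p)
   (tcoord MM x p z) - tcoord MM x p z *m gam y) xp.
rewrite -wE; congr (ycoord e (Tagged F _)).
have lw (w1 : F p) : vlift EE (y := y) w1 = v - N y v <-> w1 = w.
  split=> [h|->].
    apply: (ycoord_inj xe xp); have := vlift_chart xe (y := y) w1 ep.
    rewrite h dE => /(congr1 rsubmx); rewrite !row_mxKr wE => h'.
    exact: esym h'.
  rewrite -[LHS](tcoordK _ me ep) (vlift_chart xe)// -[RHS](tcoordK _ me ep) dE.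
  by congr (tvec _ _ _ (row_mx 0 _)); exact: wE.
rewrite /covder /sharp; case: xgetP => [w1 _ /lw//|h].
by have := h w; case; apply/lw.
Qed.

(** The section with constant fibre coordinates in the chart, cut off by a bump
    function; off the chart it vanishes, and its smoothness there is seen in
    another bundle chart. *)
Lemma section_through p (w : F p) : is_vector_bundle MM EE -> cdom x p ->
  exists2 phi, smooth_section MM EE phi & phi p = w.
Proof.
move=> vb xp; have [b [bp sb bz]] := bump_manifold (base_max xe) xp.
pose eta := ycoord e (Tagged F w).
pose lift q : F q := xget 0 [set w' | ycoord e (Tagged F w') = eta].
have liftE q : cdom x q -> ycoord e (Tagged F (lift q)) = eta.
  move=> xq; have [w' w'E] := ycoord_surj xe eta xq.
  by rewrite /lift; case: xgetP => [w1 _ //|/(_ w')].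
exists (fun q => b q *: lift q); last first.
  by rewrite bp scale1r; apply: (ycoord_inj xe xp); rewrite liftE.
move=> q; have [xq|nxq] := pselect (cdom x q).
  apply: (smooth_section_of xe xq).
  have s := smooth_scale (sb x q (base_max xe) xq) (smooth_cst eta (x q)).
  apply: near_eq_smooth s; apply: filterS (near_base_chart xe xq) => z [dz zE].
  by rewrite /= (ycoordZ xe)// liftE.
have [x' [e' [xe' xq]]] := vb q.
apply: (smooth_section_of xe' xq).
have s0 : smooth_near (cst (0 : 'rV[R]_k)) (x' q) by exact: smooth_cst.
apply: near_eq_smooth s0.
apply: filterS (near_chartP (base_max xe') xq (bz _ nxq)) => z [/= bz0 dz _].
rewrite /section_map bz0 scale0r; exact: esym (ycoord0 xe' dz).
Qed.

End Derivation.

(** * Linearity, jets and the Leibniz rule *)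

Section Linearity.
Context {R : realType} {m k : nat} {M : choiceType}.
Variables (MM : manifold R m M) (F : M -> lmodType R).
Notation E := {p : M & F p}.
Variables (EE : manifold R (m + k) E).
Variables (N : E -> 'rV[R]_(m + k) -> 'rV[R]_(m + k)).
Variables (Psi : forall y : E, jet MM EE (tag y)).
Hypotheses (connN : connection_form MM EE N) (jetPsi : jet_field_of N Psi).
Variables (x : chart (R := R) m M) (e : chart (R := R) (m + k) E).
Hypothesis xe : bundle_chart MM EE x e.
Let me := total_max xe.
Let mx := base_max xe.
Notation gam := (conn_coeff EE N e).
Notation rep phi := (ycoord e \o section_map phi \o cinv x).

(** The coefficients are the partial derivatives of [g] along the fibres at the
    zero section, hence smooth on the base. *)
Lemma linear_coefficients : fibre_linear EE N x e ->
  (forall (i : 'I_k) (mu : 'I_m) p, cdom x p ->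
     linear (fun w : F p => Gamma EE N e i mu (Tagged F w) : R^o)) /\
  exists G : 'I_k -> 'I_k -> 'I_m -> M -> R,
    (forall i j mu, smooth_fun_on MM (cdom x) (G i j mu)) /\
    forall i mu u, cdom e u ->
      Gamma EE N e i mu u = \sum_(j < k) - G i j mu (tag u) * ycoord e u 0 j.
Proof.
move=> H; have gE i mu u : Gamma EE N e i mu u = gam u mu i by rewrite [RHS]mxE.
split=> [i mu p xp a w w'|].
  rewrite !gE; apply: (etrans (congr1 (fun A : 'M[R]_(m, k) => A mu i) (H p a w w' xp))).
  by rewrite [LHS]mxE [X in X + _]mxE.
pose D (z v : 'rV[R]_(m + k)) : 'M[R]_(m, k) := 'd (gam \o cinv e) z v.
exists (fun i j mu p => - D (row_mx (x p) 0) (row_mx 0 (delta_mx 0 j)) mu i); split.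
  move=> i j mu c p Ac cp xp; apply: (change_smooth mx (atlas_max Ac) xp cp).
  have ep : cdom e (Tagged F (0 : F p)) by exact/(cdom_tag xe).
  have e0 : e (Tagged F (0 : F p)) = row_mx (x p) 0.
    by rewrite (chart_split xe)// (ycoord0 xe).
  have sD : smooth_near (fun z => D z (row_mx 0 (delta_mx 0 j))) (row_mx (x p) 0).
    by rewrite -e0; exact/smooth_diff/(conn_coeff_smooth connN jetPsi xe).
  have sr : smooth_near (fun z : 'rV[R]_m => row_mx z (0 : 'rV[R]_k)) (x p).
    by apply: smooth_row_mx; [exact: smooth_id|exact: smooth_cst].
  have s1 := smooth_coord mu i (smooth_comp sr sD).
  have s2 := smooth_scale (smooth_cst (-1 : R) (x p)) s1.
  apply: near_eq_smooth s2; apply: filterS (near_base_chart xe xp) => z [dz zE].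
  rewrite /cst /= zE; exact: scaleN1r.
move=> i mu [p w] eu; have xp : cdom x p by exact: (cdom_tag xe _).1 eu.
rewrite gE.
have Hh := linear_homogeneous H.
have E1 := homogeneous_diff0 connN jetPsi xe w Hh xp.
apply: (etrans (congr1 (fun A : 'M[R]_(m, k) => A mu i) E1)).
have yE : row_mx 0 (ycoord e (Tagged F w)) =
    \sum_j ycoord e (Tagged F w) 0 j *: row_mx 0 (delta_mx 0 j) :> 'rV[R]_(m + k).
  pose L : {linear 'rV[R]_k -> 'rV[R]_(m + k)} := mulmxr (row_mx 0 1%:M).
  have LE v : row_mx 0 v = L v by rewrite /L /= mul_mx_row mulmx0 mulmx1.
  rewrite LE [in LHS](row_sum_delta (ycoord e (Tagged F w))) linear_sum.
  by apply: eq_bigr => j _; rewrite linearZ LE.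
have E2 : 'd (gam \o cinv e) (row_mx (x p) 0) (row_mx 0 (ycoord e (Tagged F w))) =
    \sum_j ycoord e (Tagged F w) 0 j *: D (row_mx (x p) 0) (row_mx 0 (delta_mx 0 j)).
  rewrite yE; apply: (etrans (linear_sum _ _ _ _)).
  by apply: eq_bigr => j _; exact: linearZ.
apply: (etrans (congr1 (fun A : 'M[R]_(m, k) => A mu i) E2)).
rewrite summxE; apply: eq_bigr => j _; rewrite [LHS]mxE opprK mulrC.
by [].
Qed.

Lemma coefficients_linear :
  (forall (i : 'I_k) (mu : 'I_m) p, cdom x p ->
     linear (fun w : F p => Gamma EE N e i mu (Tagged F w) : R^o)) ->
  fibre_linear EE N x e.
Proof.
move=> H p a w w' xp; apply/matrixP => mu i.
have gE u : Gamma EE N e i mu u = gam u mu i by rewrite [RHS]mxE.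
have entry (A B : 'M[R]_(m, k)) : (a *: A + B) mu i = a * A mu i + B mu i.
  by rewrite !mxE.
apply: etrans (esym (entry _ _)); apply: (etrans (esym (gE _))).
apply: (etrans (H i mu p xp a w w')).
exact: (congr2 (fun b c => a * b + c) (gE _) (gE _)).
Qed.

Lemma section_sum (phi psi : forall q, F q) (a : R) p z : cdom x p ->
  differentiable (rep phi) (x p) -> differentiable (rep psi) (x p) ->
  differentiable (rep (fun q => a *: phi q + psi q)) (x p) /\
  'd (rep (fun q => a *: phi q + psi q)) (x p) z =
  a *: 'd (rep phi) (x p) z + 'd (rep psi) (x p) z.
Proof.
move=> xp d1 d2.
have [dS ES] := diff_scale (differentiable_cst a (x p)) d1.
have [dA EA] := diff_add dS d2.
have nE : {near x p, (fun z => cst a z *: rep phi z + rep psi z) =1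
    rep (fun q => a *: phi q + psi q)}.
  by apply: filterS (near_base_chart xe xp) => q [dq _]; rewrite /= (ycoordP xe).
have [dr Er] := near_eq_differentiable nE dA.
split; [exact: dr|].
apply: (etrans (congr1 (fun G : _ -> 'rV[R]_k => G z) Er)).
apply: (etrans (EA z)).
apply: (congr1 (fun v => v + _)); apply: (etrans (ES z)).
by rewrite diff_cst scale0r addr0.
Qed.

Lemma eq_jet1 p (phi psi : forall q, F q) : phi p = psi p ->
  tmap MM EE (section_map phi) p = tmap MM EE (section_map psi) p ->
  jet1 MM EE p phi = jet1 MM EE p psi.
Proof.
move=> e0 e1; apply/seteqP; split=> chi [s c0 c1].
  exact: And3 s (etrans c0 e0) (etrans c1 e1).
exact: And3 s (etrans c0 (esym e0)) (etrans c1 (esym e1)).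
Qed.

(** A jet is determined by its value and its derivative, and both are linear in
    the point of the fibre. *)
Lemma jet_linear p (a : R) (u v : F p) : fibre_linear EE N x e -> cdom x p ->
  jclass (Psi (Tagged F (a *: u + v))) =
  jet_lin a (Psi (Tagged F u)) (Psi (Tagged F v)).
Proof.
move=> H xp.
have [s0 j0 c0] := jrepP (Psi (Tagged F (a *: u + v))).
have [s1 _ c1] := jrepP (Psi (Tagged F u)).
have [s2 _ c2] := jrepP (Psi (Tagged F v)).
rewrite /jet_lin; move: s0 j0 c0 s1 c1 s2 c2.
set phi := jrep _; set phi1 := jrep _; set phi2 := jrep _ => s0 j0 c0 s1 c1 s2 c2.
have d0 := smooth_section_diff xe xp s0.
have d1 := smooth_section_diff xe xp s1.
have d2 := smooth_section_diff xe xp s2.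
have [p0 E0] := all_and2 (fun z => jet_derivative connN jetPsi xe z xp c0).
have [p1 E1] := all_and2 (fun z => jet_derivative connN jetPsi xe z xp c1).
have [p2 E2] := all_and2 (fun z => jet_derivative connN jetPsi xe z xp c2).
have pE : phi p = a *: phi1 p + phi2 p by rewrite (p0 0) (p1 0) (p2 0).
have yE : section_map phi p = section_map (fun q => a *: phi1 q + phi2 q) p.
  by rewrite /section_map pE.
have ep : cdom e (section_map phi p) by exact/(cdom_tag xe).
have tE : tmap MM EE (section_map phi) p =
    tmap MM EE (section_map (fun q => a *: phi1 q + phi2 q)) p.
  apply/funext => z.
  have [d3 E3] := section_sum a (tcoord MM x p z) xp d1 d2.
  have T0 := section_tmap xe z xp d0.
  have T3 := section_tmap xe z xp d3.
  rewrite -yE in T3.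
  apply: (etrans (esym (tcoordK _ me ep))); apply: etrans (tcoordK _ me ep).
  apply: (congr1 (tvec EE e (section_map phi p))).
  apply: (etrans T0); apply: etrans (esym T3); apply: (congr1 (row_mx _)).
  apply: (etrans (E0 _)); apply: etrans (esym E3).
  apply: etrans (esym (congr2 (fun b c => a *: b + c) (E1 _) (E2 _))).
  by rewrite H// mulmxDr -scalemxAr.
apply: (etrans j0); exact: eq_jet1.
Qed.

(** Comparing the derivatives of representatives of the two jets gives back the
    linearity of [g]. *)
Lemma linear_jet : jet_bundle_morphism Psi -> fibre_linear EE N x e.
Proof.
move=> [_ HJ] p a u v xp.
have [s0 _ c0] := jrepP (Psi (Tagged F (a *: u + v))).
have [s1 _ c1] := jrepP (Psi (Tagged F u)).
have [s2 _ c2] := jrepP (Psi (Tagged F v)).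
have := c0; rewrite HJ /jet_lin; move: s0 c0 s1 c1 s2 c2.
set phi := jrep _; set phi1 := jrep _; set phi2 := jrep _.
move=> s0 c0 s1 c1 s2 c2 [_ pE tE].
have d0 := smooth_section_diff xe xp s0.
have d1 := smooth_section_diff xe xp s1.
have d2 := smooth_section_diff xe xp s2.
have [_ E0] := all_and2 (fun z => jet_derivative connN jetPsi xe z xp c0).
have [_ E1] := all_and2 (fun z => jet_derivative connN jetPsi xe z xp c1).
have [_ E2] := all_and2 (fun z => jet_derivative connN jetPsi xe z xp c2).
have yE : section_map phi p = section_map (fun q => a *: phi1 q + phi2 q) p.
  by rewrite /section_map pE.
apply/row_matrixP => mu; rewrite !rowE.
pose z := tvec MM x p (delta_mx 0 mu).
have zE : tcoord MM x p z = delta_mx 0 mu by rewrite tvecK.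
have [d3 E3] := section_sum a (tcoord MM x p z) xp d1 d2.
have T0 := section_tmap xe z xp d0.
have T3 := section_tmap xe z xp d3.
rewrite -yE -tE in T3.
have T := congr1 rsubmx (etrans (esym T0) T3).
have T' := etrans (esym (row_mxKr _ _)) (etrans T (row_mxKr _ _)).
rewrite -zE; apply: (etrans (esym (E0 _))).
apply: (etrans T'); apply: (etrans E3).
apply: (etrans (congr2 (fun b c => a *: b + c) (E1 _) (E2 _))).
by rewrite mulmxDr -scalemxAr.
Qed.

Lemma section_leibniz (phi : forall q, F q) (f : M -> R) p z : cdom x p ->
  differentiable (rep phi) (x p) -> differentiable (f \o cinv x) (x p) ->
  differentiable (rep (fun q => f q *: phi q)) (x p) /\
  'd (rep (fun q => f q *: phi q)) (x p) z =
  f p *: 'd (rep phi) (x p) z + 'd (f \o cinv x) (x p) z *: ycoord e (section_map phi p).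
Proof.
move=> xp d1 df; have [dS ES] := diff_scale df d1.
have nE : {near x p, (fun z => (f \o cinv x) z *: rep phi z) =1
    rep (fun q => f q *: phi q)}.
  by apply: filterS (near_base_chart xe xp) => q [dq _]; rewrite /= (ycoordZ xe).
have [dr Er] := near_eq_differentiable nE dS.
split; [exact: dr|].
apply: (etrans (congr1 (fun G : _ -> 'rV[R]_k => G z) Er)).
apply: (etrans (ES z)).
by rewrite /= (cinvK mx).
Qed.

Lemma dfun_chart (f : M -> R) p z : cdom x p ->
  differentiable (f \o cinv x) (x p) ->
  dfun MM f p z = 'd (f \o cinv x) (x p) (tcoord MM x p z).
Proof.
move=> xp df.
exact: (change_diff mx (max_chart_at MM p) xp (chart_at_dom MM p) df).2.
Qed.

(** The term with [df] comes from the derivative of [f phi]; the term with [g]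
    contributes [f g(phi)] because [g] is linear. *)
Lemma linear_leibniz (f : M -> R) (phi : forall q, F q) p z :
  fibre_linear EE N x e -> cdom x p ->
  smooth_fun MM f -> smooth_section MM EE phi ->
  covder MM EE N (fun q => f q *: phi q) p z =
  dfun MM f p z *: phi p + f p *: covder MM EE N phi p z.
Proof.
move=> H xp sf sp.
have d1 := smooth_section_diff xe xp (sp p).
have df : differentiable (f \o cinv x) (x p).
  apply: smooth_differentiable.
  apply: (change_smooth (max_chart_at MM p) mx (chart_at_dom MM p) xp).
  by apply: sf => //; [exact: chart_at_atlas|exact: chart_at_dom].
have [d2 E2] := section_leibniz (tcoord MM x p z) xp d1 df.
apply: (ycoord_inj xe xp).
apply: (etrans (covder_chart connN xe z xp d2)).
rewrite (ycoordP xe)// (ycoordZ xe)// (dfun_chart z xp df).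
rewrite (covder_chart connN xe z xp d1).
apply: (etrans (congr1 (fun a => a - _) E2)).
have g0 := linear_homogeneous H.
have gE : gam (section_map (fun q => f q *: phi q) p) = f p *: gam (section_map phi p).
  have := H p (f p) (phi p) 0 xp; rewrite addr0 (homogeneous0 g0 xp) addr0.
  exact: id.
have alg (a b c : 'rV[R]_k) : a + b - c = b + (a - c) by rewrite addrAC addrC.
rewrite gE -scalemxAr scalerBr; exact: alg.
Qed.

(** Constant functions [f] and sections through arbitrary points suffice. *)
Lemma leibniz_homogeneous : is_vector_bundle MM EE ->
  (forall (f : M -> R) (phi : forall p, F p),
     smooth_fun MM f -> smooth_section MM EE phi ->
     forall p z, covder MM EE N (fun q => f q *: phi q) p z =
                 dfun MM f p z *: phi p + f p *: covder MM EE N phi p z) ->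
  homogeneous EE N x e.
Proof.
move=> vb H p w t xp t0.
have [phi sp pw] := section_through xe w vb xp; subst w.
have d1 := smooth_section_diff xe xp (sp p).
pose f : M -> R := cst t.
have sf : smooth_fun MM f by move=> c q _ _ _; exact: (smooth_cst t (c q)).
have df : differentiable (f \o cinv x) (x p) by exact: (differentiable_cst t (x p)).
apply/row_matrixP => mu; rewrite !rowE -scalemxAr.
pose z := tvec MM x p (delta_mx 0 mu).
have zE : tcoord MM x p z = delta_mx 0 mu by rewrite tvecK.
have [d2 E2] := section_leibniz (tcoord MM x p z) xp d1 df.
have df0 v : 'd (f \o cinv x) (x p) v = 0.
  exact: (congr1 (fun G : _ -> R => G v) (diff_cst t (x p))).
have L1 := congr1 (fun v => ycoord e (Tagged F v)) (H f phi sf sp p z).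
have L2 : ycoord e (Tagged F (dfun MM f p z *: phi p + f p *: covder MM EE N phi p z)) =
    t *: ycoord e (Tagged F (covder MM EE N phi p z)).
  by rewrite (dfun_chart z xp df) df0 scale0r add0r (ycoordZ xe).
have C1 := covder_chart connN xe z xp d1.
have C2 := covder_chart connN xe z xp d2.
have K1 := etrans (esym C2) (etrans L1 (etrans L2 (congr1 (fun v => t *: v) C1))).
have K2 := etrans E2 (congr1 (fun c => t *: _ + c *: _) (df0 _)).
have alg (a b b' c y : 'rV[R]_k) : c = t *: a + 0 *: y -> c - b' = t *: (a - b) ->
    b' = t *: b.
  by rewrite scale0r addr0 scalerBr => -> /addrI/oppr_inj.
rewrite -zE; exact: (alg _ _ _ _ _ K2 K1).
Qed.

End Linearity.

Theorem theorem5 (R : realType) (m k : nat) (M : choiceType)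
  (MM : manifold R m M) (F : M -> lmodType R)
  (EE : manifold R (m + k) {p : M & F p})
  (vbE : is_vector_bundle MM EE)
  (N : {p : M & F p} -> 'rV[R]_(m + k) -> 'rV[R]_(m + k))
  (Psi : forall y : {p : M & F p}, jet MM EE (tag y))
  (connN : connection_form MM EE N)
  (jetPsi : jet_field_of N Psi) :
  [<-> forall X, smooth_vf EE X ->
         forall y, lie_tensor EE (liouville EE) N X y = 0;
       forall X, smooth_vf EE X ->
         forall y, lie_tensor EE (liouville EE) (fun u v => v - N u v) X y = 0;
       forall (t : R) (y : {p : M & F p}), 0 < t ->
         tmap EE EE (dilation t) y @` horizontal N y =
         horizontal N (dilation t y);
       forall x e, bundle_chart MM EE x e ->
         (forall (i : 'I_k) (mu : 'I_m) p, cdom x p ->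
            linear (fun w : F p => Gamma EE N e i mu (Tagged F w) : R^o)) /\
         exists G : 'I_k -> 'I_k -> 'I_m -> M -> R,
           (forall i j mu, smooth_fun_on MM (cdom x) (G i j mu)) /\
           forall i mu u, cdom e u ->
             Gamma EE N e i mu u =
             \sum_(j < k) - G i j mu (tag u) * ycoord e u 0 j;
       jet_bundle_morphism Psi;
       forall (f : M -> R) (phi : forall p, F p),
         smooth_fun MM f -> smooth_section MM EE phi ->
         forall p z, covder MM EE N (fun q => f q *: phi q) p z =
                     dfun MM f p z *: phi p + f p *: covder MM EE N phi p z].
Proof.
tfae.
- move=> H X sX y; apply: (etrans (lie_tensor_complement connN y sX)).
  by rewrite H// oppr0.
- move=> H t y t0; have [x [e [xe xp]]] := vbE (tag y).
  have ey : cdom e y by exact/(cdom_tag xe).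
  apply/(dilation_horizontal connN xe t0 ey).
  have eu : euler EE N e.
    apply: (lie_euler connN jetPsi xe) => X sX u.
    apply: (can_inj opprK); rewrite oppr0.
    exact: (etrans (esym (lie_tensor_complement connN u sX)) (H X sX u)).
  have := euler_homogeneous connN jetPsi xe eu (tagged y) xp t0.
  by case: y {xp ey}.
- move=> H x e xe; apply: (linear_coefficients connN jetPsi xe).
  apply: (homogeneous_linear connN jetPsi xe) => p w t xp t0.
  have ey : cdom e (Tagged F w) by exact/(cdom_tag xe).
  exact: (dilation_horizontal connN xe t0 ey).1 (H t (Tagged F w) t0).
- move=> H; split; first by case: jetPsi => -[].
  move=> p a u v; have [x [e [xe xp]]] := vbE p.
  apply: (jet_linear connN jetPsi xe) => //.
  by apply: coefficients_linear; exact: (H x e xe).1.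
- move=> H f phi sf sp p z; have [x [e [xe xp]]] := vbE p.
  apply: (linear_leibniz connN xe) => //.
  exact: (linear_jet connN jetPsi xe H).
move=> H X sX y; have [x [e [xe xp]]] := vbE (tag y).
have ey : cdom e y by exact/(cdom_tag xe).
apply: (euler_lie connN jetPsi xe) => //.
apply: (homogeneous_euler connN jetPsi xe).
exact: (leibniz_homogeneous connN xe vbE H).
Qed.
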